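(* Consider the multi-task model $y_t=X_t\beta_t^*+W_t$, $t=1,\dots,T$, for $M\ge2$ and $T,n\ge1$. Assume that $W\in\mathbb{R}^N$, $N=nT$, is a random vector with i.i.d. $\mathcal{N}(0,\sigma^2)$ Gaussian components, $\sigma^2>0$. Let $\ell:\mathbb{R}^+\to\mathbb{R}^+$ be a nondecreasing function such that $\ell(0)=0$ and $\ell\not\equiv0$. Suppose that $s\le M/2$ and that there is a constant $\kappa_2>0$ such that $$(b)\qquad\frac{\|X\Delta\|^2}{n\|\Delta\|^2}\le\kappa_2^2\quad\text{for any }\Delta\in\mathbb{R}^{MT}\setminus\{0\}\text{ with }M(\Delta)\le2s.$$ Define $$\psi_{n,p}=\frac\sigma{\kappa_2}\,\frac{s^{1/p}}{\sqrt n}\Bigl(1+\frac{\log(eM/s)}T\Bigr)^{1/2},\qquad1\le p\le\infty,$$ where $s^{1/\infty}=1$. Then there exist positive constants $\bar b,\bar c$ depending only on $\ell(\cdot)$ and $p$ such that $$\inf_\tau\sup_{\beta^*\in GS(s,M,T)}\mathbb{E}\,\ell\Bigl(\bar b\,\psi_{n,p}^{-1}\frac1{\sqrt T}\|\tau-\beta^*\|_{2,p}\Bigr)\ge\bar c,$$ where $\inf_\tau$ denotes the infimum over all estimators $\tau$ of $\beta^*$. If, in addition, there is a constant $\kappa_1>0$ such that $$(a)\qquad\frac{\|X\Delta\|^2}{n\|\Delta\|^2}\ge\kappa_1^2\quad\text{for any }\Delta\in\mathbb{R}^{MT}\setminus\{0\}\text{ with }M(\Delta)\le2s,$$ then there exist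 positive constants $\bar b,\bar c$ depending only on $\ell(\cdot)$ such that $$\inf_\tau\sup_{\beta^*\in GS(s,M,T)}\mathbb{E}\,\ell\Bigl(\bar b\,\psi_{n,2}^{-1}\frac1{\kappa_1\sqrt{nT}}\|X(\tau-\beta^* )\|\Bigr)\ge\bar c.$$
   Context: $\mathbb{N}_\ell=\{1,\dots,\ell\}$. Multi-task model: for $t\in\mathbb{N}_T$, $X_t$ is a deterministic $n\times M$ matrix, $\beta_t^*\in\mathbb{R}^M$ is unknown, $y_t\in\mathbb{R}^n$ is observed, $W_t\in\mathbb{R}^n$ is noise. The vectors $\beta^*\in\mathbb{R}^{MT}$, $y,W\in\mathbb{R}^{nT}$ are obtained by stacking the $\beta^*_t$, $y_t$, $W_t$, and $X$ is the $nT\times MT$ block diagonal matrix with blocks $X_1,\dots,X_T$, so that $y=X\beta^*+W$. An estimator $\tau$ is an $\mathbb{R}^{MT}$-valued measurable function of the observation $y$, and $\mathbb{E}$ is the expectation under the model with true parameter $\beta^*$. For $\beta\in\mathbb{R}^{MT}$ with entries $\beta_{tj}$: $\beta^j=(\beta_{tj})_{t\in\mathbb{N}_T}\in\mathbb{R}^T$; $\|\cdot\|$ is the Euclidean norm; $\|\beta\|_{2,p}=(\sum_{j=1}^M\|\beta^j\|^p)^{1/p}$ for $1\le p<\infty$; $\|\beta\|_{2,\infty}=\max_{1\le j\le M}\|\beta^j\|$; $M(\beta)=|\{j\in\mathbb{N}_M:\beta^j\ne0\}|$. $s\ge1$ is an integer and $GS(s,M,T)=\{\beta\in\mathbb{R}^{MT}:M(\beta)\le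 s\}$. *)

(* Defs.v *)
From HB Require Import structures.
From mathcomp Require Import all_boot all_order all_algebra.
From mathcomp Require Import all_classical all_reals all_analysis.

Set Implicit Arguments.
Unset Strict Implicit.
Unset Printing Implicit Defensive.

Import Order.TTheory GRing.Theory Num.Theory.
Import numFieldNormedType.Exports.

Local Open Scope classical_set_scope.
Local Open Scope ring_scope.

(* The Borel sigma-algebra of R^(m n), presented as the one generated by the
   coordinates (as the library does for tuples). *)
Section measurable_matrix.
Context {R : realType} (m n : nat).

Definition mx_cylinder : set (set 'M[R]_(m, n)) :=
  [set C | exists (i : 'I_m) (j : 'I_n) (A : set R),
     measurable A /\ C = (fun B : 'M[R]_(m, n) => B i j) @^-1` A].

HB.instance Definition _ := @isMeasurable.Build (sigma_display mx_cylinder)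
  'M[R]_(m, n) <<s mx_cylinder >>
  (@sigma_algebra0 _ setT mx_cylinder) (@sigma_algebraC _ mx_cylinder)
  (@sigma_algebra_bigcup _ setT mx_cylinder).

End measurable_matrix.

Definition mutually_independent (R : realType) (d : measure_display)
    (Omega : measurableType d) (P : probability Omega R) (I : finType)
    (Z : I -> {RV P >-> R}) : Prop :=
  forall (J : {set I}) (A : I -> set R),
    (forall i, i \in J -> measurable (A i)) ->
    P (\bigcap_(i in [set` J]) (Z i @^-1` A i)) =
    (\prod_(i in J) P (Z i @^-1` A i))%E.
Arguments mutually_independent {R d Omega} P {I} Z.

(* The laws are compared on measurable sets only: the value of a measure on
   the other sets is a junk value. The library's [normal_prob] takes the
   standard deviation as its second parameter. *)
Definition iid_gaussian (R : realType) (d : measure_display)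
    (Omega : measurableType d) (P : probability Omega R) (I : finType)
    (sigma : R) (Z : I -> {RV P >-> R}) : Prop :=
  mutually_independent P Z /\
  forall i (A : set R), measurable A ->
    distribution P (Z i) A = normal_prob 0 sigma A.
Arguments iid_gaussian {R d Omega} P {I} sigma Z.

(* A stacked vector of R^(M T) (resp. R^(n T)) is the matrix of type 'M_(T, M)
   (resp. 'M_(T, n)) whose row t is the block of task t; hence the entry
   beta_tj is [beta t j], and the group beta^j is [col j beta]. *)

Definition euclidean_norm (R : realType) (m n : nat) (A : 'M[R]_(m, n)) : R :=
  Num.sqrt (\sum_i \sum_j A i j ^+ 2).

Definition group_norm (R : realType) (T M : nat) (p : \bar R)
    (beta : 'M[R]_(T, M)) : R :=
  match p with
  | EFin r => (\sum_(j < M) euclidean_norm (col j beta) `^ r) `^ r^-1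
  | +oo%E => \big[Num.max/0]_(j < M) euclidean_norm (col j beta)
  | -oo%E => 0
  end.

Definition group_support_size (R : realType) (T M : nat)
    (beta : 'M[R]_(T, M)) : nat :=
  #|[pred j : 'I_M | col j beta != 0]|.

Definition GS (R : realType) (s M T : nat) : set 'M[R]_(T, M) :=
  [set beta | (group_support_size beta <= s)%N].
Arguments GS : clear implicits.

(* The product of the block diagonal matrix with blocks X_t by a stacked
   vector: task by task, X_t beta_t; see [stack_design_mul]. *)
Definition design_mul (R : realType) (T n M : nat)
    (X : 'I_T -> 'M[R]_(n, M)) (beta : 'M[R]_(T, M)) : 'M[R]_(T, n) :=
  \matrix_(t < T) (X t *m (row t beta)^T)^T.

Definition stack (R : realType) (T k : nat) (A : 'M[R]_(T, k)) :
    'cV[R]_(\sum_(t < T) k) :=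
  \mxcol_(t < T) (row t A)^T.

Lemma stack_design_mul (R : realType) (T n M : nat)
    (X : 'I_T -> 'M[R]_(n, M)) (beta : 'M[R]_(T, M)) :
  stack (design_mul X beta) =
  (\mxblock_(t < T, u < T) (if t == u then X t else 0)) *m stack beta.
Proof.
rewrite /stack mul_mxblock_mxrow; apply: eq_mxcol => t.
rewrite (bigD1 t) //= eqxx big1 => [|u /negPf ut].
  by rewrite addr0 /design_mul rowK trmxK.
by rewrite eq_sym ut mul0mx.
Qed.

Definition observation (R : realType) (T n M : nat) (X : 'I_T -> 'M[R]_(n, M))
    (d : measure_display) (Omega : measurableType d) (P : probability Omega R)
    (W : 'I_T * 'I_n -> {RV P >-> R}) (beta : 'M[R]_(T, M)) (w : Omega) :
    'M[R]_(T, n) :=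
  design_mul X beta + \matrix_(t < T, i < n) W (t, i) w.
Arguments observation {R T n M} X {d Omega} P W beta w.

Definition estimators (R : realType) (T n M : nat) :
    set ('M[R]_(T, n) -> 'M[R]_(T, M)) :=
  [set tau | measurable_fun setT tau].
Arguments estimators : clear implicits.

(* [loss] takes the estimate, then the true parameter. *)
Definition minimax_risk (R : realType) (T n M : nat) (s : nat)
    (X : 'I_T -> 'M[R]_(n, M))
    (d : measure_display) (Omega : measurableType d) (P : probability Omega R)
    (W : 'I_T * 'I_n -> {RV P >-> R})
    (loss : 'M[R]_(T, M) -> 'M[R]_(T, M) -> R) : \bar R :=
  ereal_inf [set ereal_sup
    [set ('E_P[fun w => loss (tau (observation X P W beta w)) beta])%E
      | beta in GS R s M T]
    | tau in estimators R T n M].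
Arguments minimax_risk {R T n M} s X {d Omega} P W loss.

Definition rayleigh_quotient (R : realType) (T n M : nat)
    (X : 'I_T -> 'M[R]_(n, M)) (Delta : 'M[R]_(T, M)) : R :=
  euclidean_norm (design_mul X Delta) ^+ 2 /
  (n%:R * euclidean_norm Delta ^+ 2).

Definition psi (R : realType) (n M T s : nat) (sigma kappa2 : R)
    (p : \bar R) : R :=
  let s_root := if p is EFin r then s%:R `^ r^-1 else 1 in
  sigma / kappa2 * (s_root / Num.sqrt n%:R)
  * Num.sqrt (1 + ln (expR 1 * M%:R / s%:R) / T%:R).

(* Main.v *)
(* The noise being Gaussian, moving the mean of the observation from X beta0 to
   X beta multiplies its law by a likelihood ratio whose second moment is
   exp(|X (beta - beta0)|^2 / sigma^2). Hence, by AM-GM, any event C satisfies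
     2 P_beta(C) <= exp(|X (beta - beta0)|^2 / sigma^2) / lam + lam P_beta0(C).

   Take the parameters sum_k e k (om k), where om chooses independently one of m
   options in each block k, with |X (e k i)|^2 / sigma^2 <= ln m / 2. In each
   block, comparing the m options with the parameter deprived of this block shows
   that no estimator recovers om k with an average probability larger than 7/8.
   So for some om, with probability at least 1/15, a sixteenth of the blocks are
   wrong: this replaces the packing and Fano arguments, and since it controls the
   number of wrong blocks, and not only their expected number, it bounds all the
   norms (2,p) at once.

   Two such families give the two terms of the rate. If T dominates, the blocks
   are the entries (t, j) with j < s, which are 0 or a. Otherwise the blocks are s
   disjoint sets of M / s columns, in each of which one column is chosen to
   receive a single nonzero entry.

   For the prediction loss, the estimator is first replaced by an element of the
   family which predicts almost as well, so that the estimation error becomes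
   2s-sparse and condition (a) applies. *)

From HB Require Import structures.
Require Import Defs.
From mathcomp Require Import all_boot all_order all_algebra.
From mathcomp Require Import all_classical all_reals all_analysis.
From mathcomp Require Import measurable_realfun.
From mathcomp Require Import ring lra zify.

Set Implicit Arguments.
Unset Strict Implicit.
Unset Printing Implicit Defensive.

Import Order.TTheory GRing.Theory Num.Theory.
Import numFieldNormedType.Exports.

Local Open Scope classical_set_scope.
Local Open Scope ring_scope.

(** * Gaussian change of measure *)

Section density.
Local Open Scope ereal_scope.
Context d (T : measurableType d) (R : realType).
Variables (mu nu : {measure set T -> \bar R}) (h : T -> R).
Hypotheses (h0 : forall x, (0 <= h x)%R) (mh : measurable_fun setT h).
Hypothesis nuE : forall A, measurable A -> nu A = \int[mu]_(x in A) (h x)%:E.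

Import HBNNSimple.

Let h0E x : 0 <= (h x)%:E. Proof. by rewrite lee_fin. Qed.

Let mhE : measurable_fun setT (fun x => (h x)%:E).
Proof. exact/measurable_EFinP. Qed.

Let integral_density_nnsfun (f : {nnsfun T >-> R}) :
  \int[nu]_x (f x)%:E = \int[mu]_x ((f x)%:E * (h x)%:E).
Proof.
under [LHS]eq_integral do rewrite fimfunE -fsumEFin//.
rewrite [LHS]ge0_integral_fsum//; last 2 first.
  - by move=> r; exact/measurable_EFinP/measurableT_comp.
  - by move=> n x _; rewrite EFinM nnfun_muleindic_ge0.
under [RHS]eq_integral.
  move=> x xD; rewrite fimfunE -fsumEFin// ge0_mule_fsuml; last first.
    by move=> r; rewrite EFinM nnfun_muleindic_ge0.
  over.
rewrite [RHS]ge0_integral_fsum//; last 2 first.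
  - move=> r; apply: emeasurable_funM => //.
    by apply/measurable_EFinP; do 2 apply/measurableT_comp => //.
  - by move=> n x _; rewrite mule_ge0// ?EFinM ?nnfun_muleindic_ge0.
apply: eq_fsbigr => r _.
rewrite integralZl_indic_nnsfun// integral_indic// setIT nuE//.
(* A simple function here is nonnegative, so its fibre over a negative [r] is empty; for [r >= 0]
   the constant leaves the integral. *)
have [r0|r0] := leP 0%R r; last first.
  rewrite preimage_nnfun0// integral_set0 mule0; apply/esym/integral0_eq => x _.
  by rewrite indicE in_set0 mulr0 mul0e.
rewrite integral_mkcond -ge0_integralZl//.
- apply: eq_integral => x _.
  rewrite EFinM -muleA patchE indicE; congr (_ * _).
  by case: ifPn => _; rewrite ?mul1e ?mul0e.
- exact/(measurable_restrictT _ _).1/measurable_funTS.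
- by move=> x _; apply: erestrict_ge0.
Qed.

(** The hypothesis on [nu] is the case of indicators; linearity extends it to simple functions, and
    monotone convergence along [nnsfun_approx] to all nonnegative functions. *)
Lemma integral_density (f : T -> \bar R) :
  measurable_fun setT f -> (forall x, 0 <= f x) ->
  \int[nu]_x f x = \int[mu]_x (f x * (h x)%:E).
Proof.
move=> mf f0.
pose f_ := nnsfun_approx measurableT mf.
transitivity (lim (\int[nu]_x (f_ n x)%:E @[n --> \oo])).
  rewrite -monotone_convergence//=.
  - apply: eq_integral => ? /[!inE] xD; apply/esym/cvg_lim => //=.
    exact: cvg_nnsfun_approx.
  - by move=> n; exact/measurable_EFinP/measurable_funTS.
  - by move=> n ? _; rewrite lee_fin.
  - by move=> ? _ ? ? mn; rewrite lee_fin; exact/lefP/nd_nnsfun_approx.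
rewrite [RHS](_ : _ = lim (\int[mu]_x ((f_ n x)%:E * (h x)%:E) @[n --> \oo])).
  by apply: congr_lim; apply/funext => n; exact: integral_density_nnsfun.
rewrite -monotone_convergence//=.
- apply: eq_integral => x _; apply/esym/cvg_lim => //.
  apply: cvgeZr => //.
  exact: cvg_nnsfun_approx.
- move=> n; apply: emeasurable_funM => //.
  exact/measurable_EFinP/measurable_funTS.
- by move=> n ? _; rewrite mule_ge0// lee_fin.
- move=> x _ a b ab; rewrite lee_wpmul2r// lee_fin.
  exact/lefP/nd_nnsfun_approx.
Qed.

End density.

(** * Translation of a one-dimensional normal law *)

Section normal_shift.
Context {R : realType}.
Variable s : R.
Hypothesis s0 : s != 0.
Local Notation mu := (@lebesgue_measure R).

(** The pushforward gives each half-open interval its length, which characterizes Lebesgue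
    measure. *)
Lemma lebesgue_measure_shift (a : R) (A : set (measurableTypeR R)) :
  measurable A ->
  pushforward mu ((fun x => x + a) : _ -> measurableTypeR R) A = mu A.
Proof.
move=> mA; apply/esym/lebesgue_measure_unique => //=.
  exact: measurable_funD.
move=> _ _ [[x y]] _ <-; rewrite /pushforward.
rewrite (_ : _ @^-1` _ = `]x - a, y - a]%classic); last first.
  by apply/seteqP; split => z /=; rewrite !in_itv/= ltrBlDr lerBrDr.
rewrite !lebesgue_measure_itv/= !lte_fin ltrD2r; case: ifP => // _.
by rewrite -!EFinB opprD opprK addrACA addrA subrK.
Qed.

(* The likelihood ratio of N(a, s^2) with respect to N(0, s^2). *)
Definition shift_lr (a x : R) : R := expR ((a * x - a ^+ 2 / 2) / s ^+ 2).

(** Up to a constant, the square of a likelihood ratio is the likelihood ratio of the doubled shift.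
    Its integral is thus known without computing a Gaussian integral. *)
Lemma shift_lr_sqr a x :
  shift_lr a x ^+ 2 = expR (a ^+ 2 / s ^+ 2) * shift_lr (a *+ 2) x.
Proof.
rewrite /shift_lr expr2 -!expRD; congr expR.
by field.
Qed.

Lemma measurable_shift_lr a : measurable_fun setT (shift_lr a).
Proof.
apply: measurableT_comp => //; apply: measurable_funM => //.
by apply: measurable_funB => //; exact: measurable_funM.
Qed.

Lemma normal_pdf_shift a x :
  normal_pdf 0 s (x - a) = shift_lr a x * normal_pdf 0 s x.
Proof.
rewrite !normal_pdfE// mulrCA; congr (_ * _).
rewrite /normal_fun /shift_lr -expRD; congr expR.
by field.
Qed.

Lemma integral_normal_prob (f : R -> \bar R) :
  measurable_fun setT f -> (forall x, 0 <= f x)%E ->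
  (\int[normal_prob 0 s]_x f x = \int[mu]_x (f x * (normal_pdf 0 s x)%:E))%E.
Proof.
move=> mf f0; apply: (integral_density (mu := mu) (nu := normal_prob 0 s)) => //.
- by move=> x; exact: normal_pdf_ge0.
- exact: measurable_normal_pdf.
Qed.

Lemma integral_normal_shift (a : R) (g : R -> \bar R) :
  measurable_fun setT g -> (forall x, 0 <= g x)%E ->
  (\int[normal_prob 0 s]_x g (x + a)%R
   = \int[normal_prob 0 s]_x (g x * (shift_lr a x)%:E))%E.
Proof.
move=> mg g0.
have mpdf := measurable_normal_pdf 0 s.
have mD : measurable_fun setT (fun x : R => x + a) by exact: measurable_funD.
have mS := measurable_shift_lr a.
rewrite integral_normal_prob//; last exact: measurableT_comp.
rewrite integral_normal_prob//; last 2 first.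
  by apply: emeasurable_funM => //; exact/measurable_EFinP.
  by move=> x; rewrite mule_ge0// lee_fin expR_ge0.
pose F x := (g x * (shift_lr a x)%:E * (normal_pdf 0 s x)%:E)%E.
transitivity (\int[mu]_x F (x + a)%R)%E.
  apply: eq_integral => x _; rewrite /F -muleA -EFinM -normal_pdf_shift.
  by rewrite addrK.
have mF : measurable_fun setT F.
  apply: emeasurable_funM; last exact/measurable_EFinP.
  by apply: emeasurable_funM => //; exact/measurable_EFinP.
transitivity (\int[pushforward mu ((fun x => x + a)%R : _ -> measurableTypeR R)]_x F x)%E.
  rewrite ge0_integral_pushforward// => x _.
  by rewrite !mule_ge0// lee_fin ?expR_ge0 ?normal_pdf_ge0.
by apply: eq_measure_integral => A mA _; exact: lebesgue_measure_shift.
Qed.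

End normal_shift.

Section measurable_mx.
Context {R : realType} {m n : nat}.

Lemma measurable_coord i j :
  measurable_fun setT (fun B : 'M[R]_(m, n) => B i j).
Proof.
move=> _ A mA; rewrite setTI; apply: sub_sigma_algebra.
by exists i, j, A.
Qed.

Lemma measurable_fun_mx d (T : measurableType d) (f : T -> 'M[R]_(m, n)) :
  (forall i j, measurable_fun setT (fun x => f x i j)) -> measurable_fun setT f.
Proof.
move=> mf; apply: (measurability (@mx_cylinder R m n)) => //.
move=> _ [_ [i [j [A [mA ->]]]] <-].
exact: mf.
Qed.

Definition mx_rect (A : 'I_m -> 'I_n -> set R) : set 'M[R]_(m, n) :=
  [set B | forall i j, A i j (B i j)].

Lemma measurable_rect A : (forall i j, measurable (A i j)) ->
  measurable (mx_rect A).
Proof.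
move=> mA.
rewrite (_ : mx_rect A = \big[setI/setT]_(p : 'I_m * 'I_n)
   ((fun B : 'M[R]_(m, n) => B p.1 p.2) @^-1` A p.1 p.2)).
  apply: bigsetI_measurable => p _.
  by rewrite -[X in measurable X]setTI; exact: measurable_coord.
rewrite -bigcap_seq; apply/seteqP; split.
  by move=> B AB [i j] _; exact: AB.
by move=> B AB i j; apply: (AB (i, j)); rewrite /= mem_index_enum.
Qed.

(** Rectangles are stable under intersection and generate the sigma-algebra, so a finite measure is
    determined by its values on them. *)
Lemma mx_measure_unique (m1 m2 : {measure set 'M[R]_(m, n) -> \bar R}) :
  (m1 setT < +oo)%E ->
  (forall A, (forall i j, measurable (A i j)) ->
    m1 (mx_rect A) = m2 (mx_rect A)) ->
  forall D, measurable D -> m1 D = m2 D.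
Proof.
move=> m1oo m12 D mD.
pose G := [set C | exists2 A, (forall i j, measurable (A i j)) & C = mx_rect A].
have GT : G setT.
  exists (fun _ _ => setT) => //.
  by apply/seteqP; split.
apply: (measure_unique G (fun=> setT)) => //.
- rewrite eqEsubset; split.
    apply: smallest_sub; first exact: smallest_sigma_algebra.
    move=> _ [i [j [A [mA ->]]]]; apply: sub_sigma_algebra.
    (* A cylinder is a rectangle all of whose other sides are full. *)
    exists (fun i' j' => if (i', j') == (i, j) then A else setT).
      by move=> i' j'; case: ifP.
    apply/seteqP; split => [B AB i' j'|B]/=.
      by case: eqP => // -[-> ->].
    by move=> /(_ i j); rewrite eqxx.
  apply: smallest_sub; first exact: sigma_algebra_measurable.
  by move=> _ [A mA ->]; exact: measurable_rect.
- move=> _ _ [A mA ->] [B mB ->].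
  exists (fun i j => A i j `&` B i j).
    by move=> i j; exact: measurableI.
  apply/seteqP; split => [C [AC BC] i j|C ABC] /=; first by split.
  by split=> i j; have [] := ABC i j.
- by rewrite bigcup_const.
- by move=> _ [A mA ->]; exact: m12.
Qed.

Definition mx_set (p : 'I_m * 'I_n) (x : R) (w : 'M[R]_(m, n)) :=
  \matrix_(i, j) if (i, j) == p then x else w i j.

Lemma measurable_mx_set p :
  measurable_fun setT (fun z : R * 'M[R]_(m, n) => mx_set p z.1 z.2).
Proof.
apply: measurable_fun_mx => i j.
rewrite [X in measurable_fun _ X](_ : _ =
  if (i, j) == p then fst else (fun B : 'M[R]_(m, n) => B i j) \o snd); last first.
  by apply/funext => z; rewrite mxE; case: ifP.
case: ifP => _; first exact: measurable_fst.
by apply: measurableT_comp; [exact: measurable_coord|exact: measurable_snd].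
Qed.

End measurable_mx.

Section gaussian_mx.
Context {R : realType} {m n : nat}.
Variable s : R.

(** The product law is described by its values on rectangles, which avoids building a product
    measure indexed by the entries. *)
Definition gaussian_mx (nu : set 'M[R]_(m, n) -> \bar R) :=
  forall A, (forall i j, measurable (A i j)) ->
    nu (mx_rect A) = (\prod_(p : 'I_m * 'I_n) normal_prob 0 s (A p.1 p.2))%E.

Variable nu : probability 'M[R]_(m, n) R.
Hypothesis gauss : gaussian_mx nu.

(** Replacing one entry by an independent draw preserves the law of every rectangle, hence the law.
    This Fubini formula for a single entry reduces integrals over matrices to one-dimensional
    ones. *)
Lemma integral_resample p (h : 'M[R]_(m, n) -> \bar R) :
  measurable_fun setT h -> (forall w, 0 <= h w)%E ->
  (\int[nu]_w h w = \int[nu]_w \int[normal_prob 0 s]_x h (mx_set p x w))%E.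
Proof.
move=> mh h0.
pose phi (z : R * 'M[R]_(m, n)) := mx_set p z.1 z.2.
have mphi : measurable_fun setT phi by exact: measurable_mx_set.
have mhphi : measurable_fun setT (h \o phi) by exact: measurableT_comp.
rewrite -[RHS](fubini_tonelli2 (m1 := normal_prob 0 s) (m2 := nu) (h \o phi) mhphi
  (fun z => h0 (phi z))).
transitivity (\int[pushforward (normal_prob 0 s \x nu)%E phi]_w h w)%E;
  last by rewrite ge0_integral_pushforward.
apply: eq_measure_integral => D mD _.
apply: mx_measure_unique => //.
  by rewrite [ltLHS]probability_setT ltry.
move=> A mA.
rewrite [RHS](_ : _ = (normal_prob 0 s \x nu)%E (phi @^-1` mx_rect A))//.
(* The old value of the entry [p] is overwritten, so it is no longer constrained. *)
pose A' i j := if (i, j) == p then setT else A i j.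
rewrite (_ : phi @^-1` _ = A p.1 p.2 `*` mx_rect A'); last first.
  apply/seteqP; split => -[x w] /=.
    move=> AB; split.
      by have := AB p.1 p.2; rewrite /phi mxE -surjective_pairing eqxx.
    move=> i j; rewrite /A'; case: ifPn => // ijp.
    by have := AB i j; rewrite /phi mxE (negPf ijp).
  move=> [Ax Aw] i j; rewrite /phi mxE /=; case: eqP => [ijp|/eqP ijp].
    by rewrite -ijp in Ax.
  by have := Aw i j; rewrite /A' (negPf ijp).
have mA' i j : measurable (A' i j) by rewrite /A'; case: ifP.
rewrite product_measure1E; [|exact: mA|exact: measurable_rect].
transitivity (\prod_(q : 'I_m * 'I_n) normal_prob 0 s (A q.1 q.2))%E.
  exact: gauss.
rewrite (bigD1 p)//=; congr (_ * _)%E.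
transitivity (\prod_(q : 'I_m * 'I_n) normal_prob 0 s (A' q.1 q.2))%E;
  last exact/esym/gauss.
rewrite [RHS](bigD1 p)//= {1}/A' -surjective_pairing eqxx probability_setT mul1e.
by apply: eq_bigr => q qp; rewrite /A' -surjective_pairing (negPf qp).
Qed.

End gaussian_mx.

Section gaussian_shift.
Context {R : realType} {m n : nat}.
Variable s : R.
Hypothesis s0 : s != 0.
Variable nu : probability 'M[R]_(m, n) R.
Hypothesis gauss : gaussian_mx s nu.
Implicit Types (h : 'M[R]_(m, n) -> \bar R) (mu w : 'M[R]_(m, n)).

Lemma measurable_mx_shift mu :
  measurable_fun setT (fun w : 'M[R]_(m, n) => w + mu).
Proof.
apply: measurable_fun_mx => i j; under eq_fun do rewrite mxE.
by apply: measurable_funD => //; exact: measurable_coord.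
Qed.

Lemma measurable_shift_lr_coord a i j :
  measurable_fun setT (fun w : 'M[R]_(m, n) => (shift_lr s a (w i j))%:E).
Proof.
apply/measurable_EFinP; apply: measurableT_comp; last exact: measurable_coord.
exact: measurable_shift_lr.
Qed.

(** Both sides are resampled at the entry [(i, j)]; the inner integrals then agree by the
    one-dimensional formula. *)
Lemma integral_shift_coord i j a h :
  measurable_fun setT h -> (forall w, 0 <= h w)%E ->
  (\int[nu]_w h (w + a *: delta_mx i j)%R =
   \int[nu]_w (h w * (shift_lr s a (w i j))%:E))%E.
Proof.
move=> mh h0.
rewrite (integral_resample gauss (i, j) (h := fun w => h (w + _)))//; last first.
  by apply: measurableT_comp => //; exact: measurable_mx_shift.
rewrite [RHS](integral_resample gauss (i, j)); last 2 first.
- by apply: emeasurable_funM => //; exact: measurable_shift_lr_coord.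
- by move=> w; rewrite mule_ge0// lee_fin expR_ge0.
apply: eq_integral => w _.
have mg : measurable_fun setT (fun x => h (mx_set (i, j) x w)).
  apply: measurableT_comp => //; apply: measurable_fun_mx => i' j'.
  rewrite [X in measurable_fun _ X](_ : _ =
    if (i', j') == (i, j) then id else cst (w i' j')); last first.
    by apply/funext => x; rewrite mxE; case: ifP.
  by case: ifP.
transitivity (\int[normal_prob 0 s]_x h (mx_set (i, j) (x + a)%R w))%E.
  apply: eq_integral => x _; congr h; apply/matrixP => i' j'; rewrite !mxE.
  by rewrite xpair_eqE; case: (_ && _); rewrite /= ?mulr1// mulr0 addr0.
transitivity (\int[normal_prob 0 s]_x
    (h (mx_set (i, j) x w) * (shift_lr s a x)%:E))%E.
  exact: (integral_normal_shift s0 a mg (fun x => h0 (mx_set (i, j) x w))).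
by apply: eq_integral => x _; rewrite mxE eqxx.
Qed.

Definition mx_lr mu w : R := \prod_(p : 'I_m * 'I_n) shift_lr s (mu p.1 p.2) (w p.1 p.2).

Lemma mx_lr_ge0 mu w : 0 <= mx_lr mu w.
Proof. by apply: prodr_ge0 => p _; exact: expR_ge0. Qed.

Lemma measurable_mx_lr_seq (r : seq ('I_m * 'I_n)) mu :
  measurable_fun setT (fun w : 'M[R]_(m, n) =>
    (\prod_(p <- r) shift_lr s (mu p.1 p.2) (w p.1 p.2))%:E).
Proof.
apply/measurable_EFinP; apply: measurable_prod => p _.
by apply/measurable_EFinP; exact: measurable_shift_lr_coord.
Qed.

(** The entries are shifted one at a time, by induction on a duplicate-free list of them, for all
    [h] at once. *)
Lemma integral_shift mu h :
  measurable_fun setT h -> (forall w, 0 <= h w)%E ->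
  (\int[nu]_w h (w + mu)%R = \int[nu]_w (h w * (mx_lr mu w)%:E))%E.
Proof.
have E : mu = \sum_(p : 'I_m * 'I_n) mu p.1 p.2 *: delta_mx p.1 p.2.
  by rewrite {1}[mu]matrix_sum_delta pair_bigA.
rewrite {1}E /mx_lr; elim: (index_enum _) (index_enum_uniq ('I_m * 'I_n)%type) h
    => [_ h mh h0|[i j] r IHr /= /andP[ijr ur] h mh h0].
  by apply: eq_integral => w _; rewrite !big_nil addr0 mule1.
under eq_integral do rewrite big_cons [X in _ + X]addrC addrA.
rewrite (IHr ur (fun w => h (w + mu i j *: delta_mx i j)%R))//; last first.
  by apply: measurableT_comp => //; exact: measurable_mx_shift.
pose k w := (h w *
  (\prod_(p <- r) shift_lr s (mu p.1 p.2) (w p.1 p.2))%:E)%E.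
transitivity (\int[nu]_w k (w + mu i j *: delta_mx i j)%R)%E.
  apply: eq_integral => w _; rewrite /k; congr (_ * _%:E)%E.
  (* The entry [(i, j)] is not in [r], so the factors already produced do not see its shift. *)
  apply: eq_big_seq => -[i' j'] /= ijr'; rewrite !mxE.
  suff /negPf-> : ~~ ((i' == i) && (j' == j)) by rewrite mulr0 addr0.
  by rewrite -xpair_eqE; apply: contraNneq ijr => <-.
rewrite integral_shift_coord.
- by apply: eq_integral => w _; rewrite /k big_cons/= -muleA -EFinM [X in X%:E]mulrC.
- by apply: emeasurable_funM => //; exact: measurable_mx_lr_seq.
- move=> w; rewrite /k mule_ge0// lee_fin.
  by apply: prodr_ge0 => p _; exact: expR_ge0.
Qed.

Lemma mx_lr_sqr mu w :
  mx_lr mu w ^+ 2 =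
  expR ((\sum_i \sum_j mu i j ^+ 2) / s ^+ 2) * mx_lr (mu *+ 2) w.
Proof.
rewrite /mx_lr -prodrXl pair_bigA/= mulr_suml expR_sum -big_split/=.
by apply: eq_bigr => p _; rewrite shift_lr_sqr// mulmxnE.
Qed.

(** With [L] the likelihood ratio, integrate [2 L <= L ^+ 2 / lam + lam] over [D], and enlarge the
    domain of the first term to the whole space, where [mx_lr_sqr] evaluates it. *)
Lemma gaussian_transfer mu (lam : R) (D : set 'M[R]_(m, n)) :
  0 < lam -> measurable D ->
  (2%:E * nu [set w | D (w + mu)%R] <=
   (expR ((\sum_i \sum_j mu i j ^+ 2) / s ^+ 2) / lam)%:E + lam%:E * nu D)%E.
Proof.
move=> lam0 mD; set c := expR _.
have mI : measurable_fun setT (fun w : 'M[R]_(m, n) => (\1_D w : R)%:E).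
  by apply/measurable_EFinP; exact: measurable_indic.
have mL mu' : measurable_fun setT (fun w => (mx_lr mu' w)%:E).
  exact: measurable_mx_lr_seq.
(* The translation formula applied to the constant function 1. *)
have int_lr mu' : (\int[nu]_w (mx_lr mu' w)%:E = 1)%E.
  transitivity (\int[nu]_w cst 1 (w + mu')%R)%E; last first.
    by rewrite integral_cst// mul1e; exact: probability_setT.
  rewrite (integral_shift mu' (h := cst 1%E))//.
  by apply: eq_integral => w _; rewrite mul1e.
have mshift : measurable [set w : 'M[R]_(m, n) | D (w + mu)].
  rewrite -[X in measurable X]setTI.
  exact: measurable_mx_shift.
have -> : (nu [set w | D (w + mu)%R] =
    \int[nu]_w ((\1_D w : R)%:E * (mx_lr mu w)%:E))%E.
  rewrite -integral_shift//.
  transitivity (\int[nu]_w (\1_[set w | D (w + mu)%R] w : R)%:E)%E.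
    by rewrite integral_indic// setIT.
  exact: eq_integral.
have -> : (nu D = \int[nu]_w (\1_D w : R)%:E)%E by rewrite integral_indic// setIT.
rewrite -[X in (X + _)%E]mule1 -(int_lr (mu *+ 2)).
have lam0' := ltW lam0.
have mIL : measurable_fun setT (fun w => (\1_D w : R)%:E * (mx_lr mu w)%:E)%E.
  exact: emeasurable_funM.
have c0 : 0 <= c / lam by rewrite divr_ge0 ?expR_ge0.
have lr0 mu' w : (0 <= (mx_lr mu' w)%:E)%E by rewrite lee_fin mx_lr_ge0.
rewrite -!ge0_integralZl ?lee_fin//; last first.
  by move=> w _; rewrite mule_ge0// lee_fin.
rewrite -ge0_integralD//=.
- apply: ge0_le_integral => //=.
  + by move=> w _; rewrite !mule_ge0// lee_fin.
  + exact: measurable_funeM.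
  + by apply: emeasurable_funD; exact: measurable_funeM.
  + move=> w _; rewrite -!EFinM -EFinD lee_fin mulrAC -mx_lr_sqr.
    set L := mx_lr mu w; rewrite indicE; case: (w \in D) => /=.
      have : 0 <= (L - lam) ^+ 2 / lam by rewrite divr_ge0 ?sqr_ge0.
      rewrite (_ : _ / lam = L ^+ 2 / lam + lam - 2 * L); first by lra.
      by field; exact: lt0r_neq0.
    by rewrite mul0r !mulr0 addr0 divr_ge0 ?sqr_ge0.
- by move=> w _; rewrite mule_ge0.
- exact: measurable_funeM.
- by move=> w _; rewrite mule_ge0// lee_fin.
- exact: measurable_funeM.
Qed.

End gaussian_shift.

(** * Law of the observation *)

Section design.
Context {R : realType} {T n M : nat}.
Variable X : 'I_T -> 'M[R]_(n, M).

Lemma design_mulE beta t i :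
  design_mul X beta t i = \sum_j X t i j * beta t j.
Proof. by rewrite !mxE; apply: eq_bigr => j _; rewrite !mxE. Qed.

Lemma design_mulD beta1 beta2 :
  design_mul X (beta1 + beta2) = design_mul X beta1 + design_mul X beta2.
Proof.
apply/matrixP => t i; rewrite [RHS]mxE !design_mulE -big_split/=.
by apply: eq_bigr => j _; rewrite mxE mulrDr.
Qed.

Lemma design_mulN beta : design_mul X (- beta) = - design_mul X beta.
Proof.
apply/matrixP => t i; rewrite [RHS]mxE !design_mulE -sumrN.
by apply: eq_bigr => j _; rewrite mxE mulrN.
Qed.

End design.

Section euclidean.
Context {R : realType} {m n : nat}.
Implicit Types A B : 'M[R]_(m, n).

Lemma sqr_euclidean_norm A :
  euclidean_norm A ^+ 2 = \sum_i \sum_j A i j ^+ 2.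
Proof.
by rewrite sqr_sqrtr// sumr_ge0// => i _; rewrite sumr_ge0// => j _; rewrite sqr_ge0.
Qed.

Lemma euclidean_norm_ge0 A : 0 <= euclidean_norm A.
Proof. exact: sqrtr_ge0. Qed.

End euclidean.

Section observation_law.
Context {R : realType} {T n : nat} {d : measure_display}.
Context {Omega : measurableType d}.
Variables (P : probability Omega R) (W : 'I_T * 'I_n -> {RV P >-> R}).

Definition noise (w : Omega) : 'M[R]_(T, n) := \matrix_(t, i) W (t, i) w.

Lemma measurable_noise : measurable_fun setT noise.
Proof.
apply: measurable_fun_mx => t i.
rewrite [X in measurable_fun _ X](_ : _ = (W (t, i) : Omega -> R)).
  exact: measurable_funP.
by apply/funext => w; rewrite mxE.
Qed.

HB.instance Definition _ :=
  isMeasurableFun.Build _ _ _ _ noise measurable_noise.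

Lemma gaussian_noise sigma : iid_gaussian P sigma W ->
  gaussian_mx sigma (distribution P noise).
Proof.
move=> [indep law] A mA.
rewrite /distribution/= /pushforward; pose J := finset.setTfor ('I_T * 'I_n)%type.
transitivity (\prod_(p in J) P (W p @^-1` A p.1 p.2))%E; last first.
  by apply: eq_big => [p|p _]; [rewrite finset.in_setT|exact: law].
rewrite -(indep J (fun p => A p.1 p.2))//; congr (P _).
apply/seteqP; split => [w Aw [i j] _|w Aw i j] /=.
  by have := Aw i j; rewrite mxE.
by rewrite mxE; apply: (Aw (i, j)); rewrite /= finset.in_setT.
Qed.

Context {M : nat} (X : 'I_T -> 'M[R]_(n, M)).

Lemma measurable_observation beta : measurable_fun setT (observation X P W beta).
Proof.
apply: (measurableT_comp _ measurable_noise (f := fun w => design_mul X beta + w)).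
by under eq_fun do rewrite addrC; exact: measurable_mx_shift.
Qed.

(** The observation under [beta] is the one under [beta0] with noise translated by [mu], the image
    under the design of [beta - beta0]. *)
Lemma observation_transfer sigma beta beta0 (lam : R) (C : set 'M[R]_(T, n)) :
  0 < sigma -> iid_gaussian P sigma W -> 0 < lam -> measurable C ->
  (2%:E * P (observation X P W beta @^-1` C) <=
   (expR (euclidean_norm (design_mul X (beta - beta0)) ^+ 2 / sigma ^+ 2) / lam)%:E
   + lam%:E * P (observation X P W beta0 @^-1` C))%E.
Proof.
move=> sigma0 iid lam0 mC; set mu := design_mul X (beta - beta0).
have mD : measurable [set w : 'M[R]_(T, n) | C (design_mul X beta0 + w)].
  rewrite -[X in measurable X]setTI.
  rewrite (_ : [set _ | _] = (fun w => w + design_mul X beta0) @^-1` C).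
    exact: measurable_mx_shift.
  by apply/seteqP; split => w /=; rewrite addrC.
rewrite (_ : observation X P W beta @^-1` C =
  noise @^-1` [set w | C (design_mul X beta0 + (w + mu))]); last first.
  apply/seteqP; split => w; rewrite /preimage/= /observation /mu design_mulD;
    by rewrite design_mulN addrCA subrKC addrC.
rewrite sqr_euclidean_norm.
have := gaussian_transfer (lt0r_neq0 sigma0) (gaussian_noise iid) mu lam0 mD.
by apply.
Qed.

End observation_law.

(** * Many blocks are wrong for some parameter *)

Section counting.
Context {R : realType} {d : measure_display} {Omega : measurableType d}.
Variable P : probability Omega R.

Lemma sum_fine_probability (I : finType) (E : I -> set Omega) :
  (forall i, measurable (E i)) ->
  (\int[P]_w (\sum_i (\1_(E i) w : R))%:E)%E = (\sum_i fine (P (E i)))%:E.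
Proof.
move=> mE; under eq_integral do rewrite -sumEFin.
rewrite ge0_integral_sum//; last first.
- by move=> i; apply/measurable_EFinP; exact: measurable_indic.
rewrite -sumEFin; apply: eq_bigr => i _.
by rewrite integral_indic// setIT fineK// fin_num_measure.
Qed.

Lemma measurable_sum_indic (I : finType) (E : I -> set Omega) :
  (forall i, measurable (E i)) ->
  measurable_fun setT (fun w => (\sum_i (\1_(E i) w : R))).
Proof.
by move=> mE; apply: measurable_sum => i; exact: measurable_indic.
Qed.

Lemma sum_disjoint_le1 (I : finType) (E : I -> set Omega) :
  (forall i, measurable (E i)) ->
  (forall i j, i != j -> E i `&` E j = set0) ->
  \sum_i fine (P (E i)) <= 1.
Proof.
move=> mE dE; rewrite -lee_fin -sum_fine_probability//.
apply: (@le_trans _ _ (\int[P]_w cst 1 w)%E); last first.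
  by rewrite integral_cst// mul1e probability_le1.
apply: ge0_le_integral => //.
- by move=> w _; rewrite lee_fin sumr_ge0.
- by apply/measurable_EFinP; exact: measurable_sum_indic.
move=> w _; rewrite lee_fin.
have [[i Ei]|nE] := pselect (exists i, E i w); last first.
  by rewrite big1// => i _; rewrite indicE memNset// => Ei; apply: nE; exists i.
rewrite (bigD1 i)//= big1 ?addr0 => [|j ji]; first by rewrite indicE; case: (_ \in _).
rewrite indicE memNset// => Ej.
by have : (E j `&` E i) w by []; rewrite dE.
Qed.

(** Markov's inequality for the number of events that occur. *)
Lemma markov_count (I : finType) (E : I -> set Omega) (a : R) :
  0 <= a -> (forall i, measurable (E i)) ->
  a * fine (P [set w | a <= \sum_i (\1_(E i) w : R)]) <= \sum_i fine (P (E i)).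
Proof.
move=> a0 mE.
have mY : measurable [set w | a <= \sum_i (\1_(E i) w : R)].
  rewrite -[X in measurable X]setTI.
  have := measurable_sum_indic mE; move=> /(_ measurableT `[a, +oo[%classic).
  rewrite (_ : _ @^-1` _ = [set w | a <= \sum_i (\1_(E i) w : R)]); first exact.
  by apply/seteqP; split => w /=; rewrite in_itv/= andbT.
rewrite -lee_fin EFinM -sum_fine_probability// fineK ?fin_num_measure//.
set Y := [set _ | _] in mY *.
have -> : P Y = (\int[P]_w (\1_Y w : R)%:E)%E by rewrite integral_indic// setIT.
rewrite -ge0_integralZl//; last by apply/measurable_EFinP; exact: measurable_indic.
apply: ge0_le_integral => //.
- by move=> w _; rewrite mule_ge0// lee_fin.
- by apply: measurable_funeM; apply/measurable_EFinP; exact: measurable_indic.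
- by apply/measurable_EFinP; exact: measurable_sum_indic.
move=> w _; rewrite -EFinM lee_fin indicE.
have [wY|wY] := boolP (w \in Y); first by move: wY; rewrite inE mulr1.
by rewrite mulr0 sumr_ge0.
Qed.

End counting.

Section bayes.
Context {R : realType} {K : finType} {m : nat}.
Implicit Types om : {ffun K -> 'I_m}.

Definition upd om k i : {ffun K -> 'I_m} := [ffun k' => if k' == k then i else om k'].

(* Resampling the choice in one block preserves the uniform prior. *)
Lemma sum_upd (F : {ffun K -> 'I_m} -> R) k :
  \sum_om \sum_i F (upd om k i) = m%:R * \sum_om F om.
Proof.
rewrite pair_bigA/=.
(* Exchanging the choice made in block [k] with the fresh index is an involution, so it reindexes
   the double sum. *)
pose h (z : {ffun K -> 'I_m} * 'I_m) := (upd z.1 k z.2, z.1 k).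
have hK : involutive h.
  move=> [om i]; congr (_, _); last by rewrite ffunE eqxx.
  by apply/ffunP => k'; rewrite !ffunE; case: eqP => [->|].
rewrite [LHS](reindex_inj (inv_inj hK))/=.
transitivity (\sum_(om : {ffun K -> 'I_m}) \sum_(i < m) F om).
  rewrite pair_bigA; apply: eq_bigr => -[om i] _ /=; congr F.
  by apply/ffunP => k'; rewrite !ffunE; case: eqP => [->|].
rewrite mulr_sumr; apply: eq_bigr => om _.
by rewrite sumr_const card_ord mulr_natl.
Qed.

(** By [sum_upd], the uniform average over [om] of each [F om k] is at most [q]; some [om] does no
    worse than the average of the sum over [k]. *)
Lemma exists_sum_le_of_average (F : {ffun K -> 'I_m} -> K -> R) (q : R) :
  (0 < m)%N ->
  (forall om k, \sum_i F (upd om k i) k <= q * m%:R) ->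
  exists om, \sum_k F om k <= q * #|K|%:R.
Proof.
move=> m0 HF; apply: contrapT => /forallNP H.
have m0R : 0 < m%:R :> R by rewrite ltr0n.
pose Om := {ffun K -> 'I_m}.
have lower : \sum_(om : Om) q * #|K|%:R < \sum_(om : Om) \sum_k F om k.
  apply: ltr_sum => [|om _]; last by rewrite ltNge; apply/negP; exact: H.
  by apply/hasP; exists [ffun=> Ordinal m0]; rewrite ?mem_index_enum.
suff : \sum_(om : Om) \sum_k F om k <= \sum_(om : Om) q * #|K|%:R.
  by rewrite leNgt lower.
have HS k : \sum_(om : Om) F om k <= q * #|{: Om}|%:R.
  rewrite -(ler_pM2l m0R) -(sum_upd (F^~ k) k) mulrA [m%:R * q]mulrC.
  rewrite mulr_natr -sumr_const.
  by apply: ler_sum => om _; exact: HF.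
rewrite exchange_big/=; apply: le_trans (ler_sum _ (fun k _ => HS k)) _.
have cst_sum (I : finType) (c : R) : \sum_(i : I) c = c * #|I|%:R.
  by rewrite sumr_const mulr_natr.
by rewrite !cst_sum mulrAC.
Qed.

End bayes.

Section hypothesis_testing.
Context {R : realType} {T n M : nat} {d : measure_display}.
Context {Omega : measurableType d}.
Variables (X : 'I_T -> 'M[R]_(n, M)) (P : probability Omega R).
Variables (W : 'I_T * 'I_n -> {RV P >-> R}) (sigma : R).
Hypotheses (sigma0 : 0 < sigma) (iid : iid_gaussian P sigma W).
Context {K : finType} {m : nat}.
Hypothesis m_ge2 : (2 <= m)%N.
Variable e : K -> 'I_m -> 'M[R]_(T, M).

Definition hypothesis (om : {ffun K -> 'I_m}) := \sum_k e k (om k).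

Lemma hypothesis_upd om k i :
  hypothesis (upd om k i) = e k i + \sum_(k' | k' != k) e k' (om k').
Proof.
rewrite /hypothesis (bigD1 k)//= ffunE eqxx; congr (_ + _).
by apply: eq_bigr => k' /negPf kk'; rewrite ffunE kk'.
Qed.

(** [C om k y] means that from [y] the block [k] of [om] counts as recovered. By [disjC], once the
    other blocks are fixed, at most one option can be recovered in a block. *)
Variable C : {ffun K -> 'I_m} -> K -> 'M[R]_(T, n) -> bool.
Hypothesis mC : forall om k, measurable [set y | C om k y].
Hypothesis disjC : forall om k i j y,
  C (upd om k i) k y -> C (upd om k j) k y -> i = j.
Hypothesis energy : forall k i,
  euclidean_norm (design_mul X (e k i)) ^+ 2 / sigma ^+ 2 <= ln m%:R / 2.

Let Y om := observation X P W (hypothesis om).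

Let success om k := fine (P (Y om @^-1` [set y | C om k y])).

(** Each success probability is compared with the one under [beta0], which does not depend on the
    option; there the events are disjoint, so their probabilities sum to at most 1. *)
Lemma average_success om k :
  \sum_i success (upd om k i) k <= 7 / 8 * m%:R.
Proof.
pose beta0 := \sum_(k' | k' != k) e k' (om k').
have updE i : hypothesis (upd om k i) - beta0 = e k i.
  by rewrite hypothesis_upd addrK.
have a2 : 2 <= m%:R :> R by rewrite ler_nat.
move: a2 (fun i => energy k i); move Ea : (m%:R : R) => a a2 en.
have a0 : 0 < a by exact: lt_le_trans a2.
(* With [q] the square root of [a], twice the sum is at most [4 / 3 * q + 3 / 4 * a]. Since [a >= 2]
   gives [q >= 4 / 3], the first term is at most [a], and the total at most [7 / 4 * a]. *)
pose lam := 3 / 4 * a.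
have lam0 : 0 < lam by rewrite mulr_gt0.
pose g i := fine (P (observation X P W beta0 @^-1` [set y | C (upd om k i) k y])).
have mE beta i : measurable (observation X P W beta @^-1` [set y | C (upd om k i) k y]).
  by rewrite -[X in measurable X]setTI; exact: measurable_observation.
have g1 : \sum_i g i <= 1.
  apply: sum_disjoint_le1 => // i j ij; apply/seteqP; split => // w [/= Ci Cj].
  by move/eqP: ij; apply; exact: disjC Ci Cj.
pose q := expR (ln a / 2).
have q0 : 0 < q by exact: expR_gt0.
have qq : q ^+ 2 = a.
  by rewrite expr2 -expRD -splitr lnK// posrE.
have step i : 2 * success (upd om k i) k <= q / lam + lam * g i.
  have := observation_transfer X (hypothesis (upd om k i)) beta0 sigma0 iid lam0
    (mC (upd om k i) k).
  rewrite updE -[P (_ (hypothesis _) @^-1` _)]fineK ?fin_num_measure//.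
  rewrite -[P (_ beta0 @^-1` _)]fineK ?fin_num_measure//.
  rewrite -!EFinM -EFinD lee_fin => /le_trans; apply.
  by rewrite lerD2r ler_pM2r ?invr_gt0// ler_expR.
have sum_step : 2 * \sum_i success (upd om k i) k <= a * (q / lam) + lam.
  rewrite mulr_sumr; apply: le_trans (ler_sum _ (fun i _ => step i)) _.
  rewrite big_split/= sumr_const card_ord -[_ *+ m]mulr_natl Ea lerD2l.
  by rewrite -mulr_sumr ler_piMr// ltW.
have q43 : 4 / 3 <= q by rewrite -ler_sqr ?nnegrE ?(ltW q0)// qq; lra.
have alam : a * (q / lam) = 4 / 3 * q.
  by rewrite /lam; field; rewrite lt0r_neq0.
have : 4 / 3 * q <= a by rewrite -qq expr2 ler_pM2r.
rewrite alam /lam in sum_step; move: sum_step; lra.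
Qed.

(** Some [om] has at most 7/8 of its blocks recovered on average. By Markov, 15/16 of them are
    recovered with probability at most (7/8) / (15/16) = 14/15; [E] is the complementary event. *)
Lemma exists_hard_hypothesis : (0 < #|K|)%N ->
  exists om, exists2 E : set Omega, measurable E /\ ((15^-1 : R)%:E <= P E)%E &
    forall w, E w -> (#|K| <= 16 * #|[pred k | ~~ C om k (Y om w)]|)%N.
Proof.
move=> K0; have [om omP] := exists_sum_le_of_average (ltnW m_ge2) average_success.
pose F k := Y om @^-1` [set y | C om k y].
have mF k : measurable (F k).
  by rewrite -[X in measurable X]setTI; exact: measurable_observation.
have N0 : 0 < #|K|%:R :> R by rewrite ltr0n.
have a0 : 0 <= 15 / 16 * #|K|%:R :> R by rewrite mulr_ge0 ?divr_ge0// ltW.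
have := markov_count P a0 mF; set B := [set w | _] => markov.
have mB : measurable B.
  rewrite -[X in measurable X]setTI.
  have := measurable_sum_indic (R := R) mF.
  move=> /(_ measurableT `[15 / 16 * #|K|%:R, +oo[%classic).
  rewrite (_ : _ @^-1` _ = B); first exact.
  by apply/seteqP; split => w /=; rewrite in_itv/= andbT.
have PB : fine (P B) <= 14 / 15.
  rewrite -(ler_pM2l (_ : 0 < 15 / 16 * #|K|%:R)) ?mulr_gt0//.
  apply: le_trans markov _; apply: le_trans omP _.
  lra.
exists om, (~` B).
  split; first exact: measurableC.
  rewrite probability_setC// -[P B]fineK ?fin_num_measure// -EFinB lee_fin.
  lra.
move=> w /negP; rewrite -ltNge.
rewrite (_ : \sum_k _ = #|[pred k | C om k (Y om w)]|%:R); last first.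
  rewrite -sum1_card natr_sum [RHS]big_mkcond/=; apply: eq_bigr => k _.
  rewrite indicE (_ : (w \in F k) = C om k (Y om w)); first by rewrite inE; case: ifP.
  by apply/idP/idP; rewrite inE.
rewrite -(cardC [pred k | C om k (Y om w)]) natrD => wB.
have : (15 * #|[pred k | ~~ C om k (Y om w)]|)%:R >
       #|[pred k | C om k (Y om w)]|%:R :> R.
  rewrite natrM (_ : #|[pred k | ~~ _]| = #|[predC [pred k | C om k (Y om w)]]|)//.
  lra.
rewrite ltr_nat => /ltnW cB.
by rewrite (mulSn 15) [leqRHS]addnC leq_add.
Qed.

End hypothesis_testing.

Section separated_hypotheses.
Context {R : realType} {T n M : nat} {d : measure_display}.
Context {Omega : measurableType d}.
Variables (X : 'I_T -> 'M[R]_(n, M)) (P : probability Omega R).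
Variables (W : 'I_T * 'I_n -> {RV P >-> R}) (sigma : R).
Hypotheses (sigma0 : 0 < sigma) (iid : iid_gaussian P sigma W).
Context {K : finType} {m : nat}.
Hypothesis m_ge2 : (2 <= m)%N.
Variables (e : K -> 'I_m -> 'M[R]_(T, M)) (pos : K -> {set 'I_T * 'I_M}) (a : R).
Hypothesis energy : forall k i,
  euclidean_norm (design_mul X (e k i)) ^+ 2 / sigma ^+ 2 <= ln m%:R / 2.
Hypothesis separated : forall k i j, i != j ->
  exists2 p, p \in pos k & a <= `|e k i p.1 p.2 - e k j p.1 p.2|.

Variable tau : 'M[R]_(T, n) -> 'M[R]_(T, M).
Hypothesis mtau : forall t j, measurable_fun setT (fun y => tau y t j).

(** By the triangle inequality at a separating entry, two options of a block cannot both be at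
    distance less than [a / 2]. The failure of [C] exhibits an entry of the block with error at
    least [a / 2]. *)
Let C om k (y : 'M[R]_(T, n)) :=
  [forall (p | p \in pos k), `|(tau y - hypothesis e om) p.1 p.2| < a / 2].

Let mC om k : measurable [set y | C om k y].
Proof.
rewrite (_ : [set _ | _] = \bigcap_(p in [set` pos k])
   [set y | `|(tau y - hypothesis e om) p.1 p.2| < a / 2]); last first.
  by apply/seteqP; split => [y /forall_inP|y yC]; last exact/forall_inP.
apply: fin_bigcap_measurable => // p _.
have mf : measurable_fun setT
    (fun y => `|tau y p.1 p.2 - hypothesis e om p.1 p.2|).
  by apply: measurableT_comp => //; exact: measurable_funB.
have := mf measurableT `]-oo, (a / 2)[%classic.
rewrite setTI (_ : _ @^-1` _ =
  [set y | `|(tau y - hypothesis e om) p.1 p.2| < a / 2]); first exact.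
by apply/seteqP; split => y /=; rewrite !mxE in_itv.
Qed.

Let disjC om k i j y : C (upd om k i) k y -> C (upd om k j) k y -> i = j.
Proof.
move=> /forall_inP Ci /forall_inP Cj; apply/eqP/negPn/negP => ij.
have [p pk] := separated k ij; have := Cj p pk; have := Ci p pk.
rewrite !hypothesis_upd; set c := \sum_(_ | _) _; rewrite !mxE => Hi Hj.
apply/negP; rewrite -ltNge [a]splitr; apply: le_lt_trans (ltrD Hj Hi).
rewrite (_ : _ - _ = (tau y p.1 p.2 - (e k j p.1 p.2 + c p.1 p.2)) -
  (tau y p.1 p.2 - (e k i p.1 p.2 + c p.1 p.2))); last by ring.
exact: ler_normB.
Qed.

Lemma exists_far_hypothesis : (0 < #|K|)%N ->
  exists om, exists2 E : set Omega, measurable E /\ ((15^-1 : R)%:E <= P E)%E &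
    forall w, E w -> (#|K| <= 16 * #|[pred k | [exists (p | p \in pos k),
      (a / 2 <= `|(tau (observation X P W (hypothesis e om) w) - hypothesis e om)
                    p.1 p.2|)%R] ]|)%N.
Proof.
move=> K0; have [om [E mE EP]] :=
  exists_hard_hypothesis sigma0 iid m_ge2 mC disjC energy K0.
exists om, E => // w /EP; congr (_ <= 16 * _)%N; apply: eq_card => k.
rewrite !inE negb_forall; apply: eq_existsb => p.
by rewrite negb_imply -leNgt.
Qed.

End separated_hypotheses.

(** * Norms, sparsity and counting of columns *)

Section norms.
Context {R : realType} {T M : nat}.
Implicit Types A : 'M[R]_(T, M).

Definition s_root (p : \bar R) (s : nat) : R := if p is r%:E then s%:R `^ r^-1 else 1.

(** For finite [p], the s/32 large columns give [x] times the power 1/p of s/32; as 1/p is at most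
    1, the constant 1/32 comes out uniformly in [p]. For infinite [p] one large column is enough. *)
Lemma group_norm_lower_bound A (p : \bar R) (s : nat) (x : R) :
  (1 <= p)%E -> (1 <= s)%N -> 0 <= x ->
  (s <= 32 * #|[pred j | (x <= euclidean_norm (col j A))%R]|)%N ->
  x * s_root p s / 32 <= group_norm p A.
Proof.
move=> p1 s1 x0; set J := #|_| => sJ.
have J0 : (0 < J)%N by rewrite lt0n; apply: contraTneq sJ => ->; rewrite -ltnNge.
case: p p1 => [r|_|//] /=; last first.
  have /card_gt0P[j] := J0; rewrite inE => xj.
  apply: (@le_trans _ _ x); last exact: le_trans xj (le_bigmax_cond _ _ _).
  lra.
rewrite lee_fin => r1; have r0 : 0 < r by exact: lt_le_trans r1.
have rV0 : 0 <= r^-1 by rewrite invr_ge0 ltW.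
have rV1 : r^-1 <= 1 by rewrite invf_le1.
have step : J%:R * x `^ r <= \sum_(j < M) euclidean_norm (col j A) `^ r.
  rewrite mulr_natl -sumr_const big_mkcond/=; apply: ler_sum => j _.
  rewrite inE; case: ifP => [xj|_]; last exact: powR_ge0.
  by rewrite ge0_ler_powR ?nnegrE ?euclidean_norm_ge0// ltW.
apply: (@le_trans _ _ ((J%:R * x `^ r) `^ r^-1)); last first.
  rewrite ge0_ler_powR// nnegrE ?mulr_ge0 ?powR_ge0// sumr_ge0// => j _.
  exact: powR_ge0.
rewrite powRM ?powR_ge0// -powRrM mulfV ?gt_eqF// powRr1// [leRHS]mulrC -mulrA.
rewrite ler_wpM2l//.
have sJ' : s%:R <= 32 * J%:R :> R by rewrite -natrM ler_nat.
have -> : J%:R = 32 * J%:R / 32 :> R by field.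
apply: (@le_trans _ _ ((s%:R / 32) `^ r^-1)); last first.
  by rewrite ge0_ler_powR// ?nnegrE ?divr_ge0// ler_pM2r// invr_gt0.
rewrite ler_pdivrMr//.
rewrite -{1}[s%:R](divfK (_ : 32 != 0))// powRM ?divr_ge0//.
rewrite ler_wpM2l ?powR_ge0// -[leRHS]powRr1//.
by rewrite ler_powR// ler1n.
Qed.

End norms.

Section sparsity.
Context {R : realType} {T n M : nat}.
Variable X : 'I_T -> 'M[R]_(n, M).

Lemma design_mulZ c beta : design_mul X (c *: beta) = c *: design_mul X beta.
Proof.
apply/matrixP => t i; rewrite [RHS]mxE !design_mulE mulr_sumr.
by apply: eq_bigr => j _; rewrite mxE mulrCA.
Qed.

Lemma sqr_euclidean_normZ m k c (A : 'M[R]_(m, k)) :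
  euclidean_norm (c *: A) ^+ 2 = c ^+ 2 * euclidean_norm A ^+ 2.
Proof.
rewrite !sqr_euclidean_norm mulr_sumr; apply: eq_bigr => i _.
by rewrite mulr_sumr; apply: eq_bigr => j _; rewrite mxE exprMn.
Qed.

Lemma sqr_euclidean_norm_delta m k (i : 'I_m) (j : 'I_k) :
  euclidean_norm (delta_mx i j : 'M[R]_(m, k)) ^+ 2 = 1.
Proof.
rewrite sqr_euclidean_norm (bigD1 i)//= [X in _ + X]big1 ?addr0 => [|i' ii'].
  rewrite (bigD1 j)//= big1 ?addr0 => [|j' jj']; first by rewrite mxE !eqxx expr1n.
  by rewrite mxE (negPf jj') andbF expr0n.
by rewrite big1// => j' _; rewrite mxE (negPf ii') expr0n.
Qed.

Lemma group_support_size_le (J : {set 'I_M}) (beta : 'M[R]_(T, M)) :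
  (forall t j, j \notin J -> beta t j = 0) -> (group_support_size beta <= #|J|)%N.
Proof.
move=> betaJ; apply/subset_leq_card/fintype.subsetP => j; rewrite inE.
apply: contraR => jJ; apply/eqP/matrixP => t k; rewrite !mxE.
exact: betaJ.
Qed.

(** The sparsity condition is applied to [delta_mx t j], which is nonzero, and then scaled, so that
    [c = 0] is covered: it is one of the two options in the family of rows. *)
Lemma design_delta_le (s : nat) (kappa c : R) t j : (0 < n)%N -> (1 <= s)%N ->
  (forall Delta : 'M[R]_(T, M), Delta != 0 ->
     (group_support_size Delta <= 2 * s)%N ->
     rayleigh_quotient X Delta <= kappa ^+ 2) ->
  euclidean_norm (design_mul X (c *: delta_mx t j)) ^+ 2 <=
    kappa ^+ 2 * (n%:R * c ^+ 2).
Proof.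
move=> n0 s1 upper.
rewrite design_mulZ sqr_euclidean_normZ mulrA [leRHS]mulrC ler_wpM2l ?sqr_ge0//.
have := upper (delta_mx t j); rewrite /rayleigh_quotient sqr_euclidean_norm_delta.
rewrite mulr1 ler_pdivrMr ?ltr0n//; apply.
  by apply/eqP => /matrixP/(_ t j); rewrite !mxE !eqxx; apply/eqP/oner_neq0.
apply: leq_trans (_ : #|finset.set1 j| <= _)%N; last by rewrite finset.cards1 muln_gt0.
apply: group_support_size_le => t' j'; rewrite finset.in_set1 => /negPf jj'.
by rewrite mxE jj' andbF.
Qed.

End sparsity.

(** Light columns hold at most T s / 32 of the marked entries. At least as many are left for the
    columns of [J], which hold at most T each. *)
Lemma count_columns (T s : nat) (b : 'I_T -> 'I_s -> bool) : (0 < T)%N ->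
  (T * s <= 16 * #|[pred z : 'I_T * 'I_s | b z.1 z.2]|)%N ->
  (s <= 32 * #|[pred j | T <= 32 * #|[pred t | b t j]|]|)%N.
Proof.
move=> T0; pose J := [pred j | T <= 32 * #|[pred t | b t j]|]%N; rewrite -/J.
have -> : #|[pred z : 'I_T * 'I_s | b z.1 z.2]| = (\sum_j #|[pred t | b t j]|)%N.
  rewrite -sum1_card big_mkcond/= -(pair_bigA _ (fun t j => if b t j then 1 else 0)%N).
  rewrite exchange_big/=; apply: eq_bigr => j _.
  by rewrite -sum1_card [RHS]big_mkcond.
move=> many; rewrite -(leq_pmul2l T0).
have step j : (32 * #|[pred t | b t j]| <= T + 32 * T * (j \in J))%N.
  have [_|] := boolP (j \in J); last first.
    by rewrite inE -ltnNge => /ltnW jT; rewrite muln0 addn0.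
  apply: leq_trans (leq_addl _ _); rewrite muln1 leq_mul2l/=.
  by apply: leq_trans (max_card _) _; rewrite card_ord.
have := leq_sum (index_enum 'I_s) (P := xpredT) (fun j _ => step j).
rewrite -big_distrr/= big_split/= sum_nat_const card_ord -big_distrr/=.
have -> : (\sum_(j < s) (j \in J) = #|J|)%N.
  by rewrite -sum1_card [RHS]big_mkcond/=; apply: eq_bigr => j _; case: (j \in J).
move: many; rewrite -mulnA [(s * T)%N]mulnC [(T * (32 * _))%N]mulnCA.
by move: (\sum_j _)%N (T * s)%N (T * #|J|)%N => x y z; lia.
Qed.

(** * The two families of parameters *)

Section column_norms.
Context {R : realType} {T M : nat}.
Implicit Types A : 'M[R]_(T, M).

Lemma sqr_norm_col A j : euclidean_norm (col j A) ^+ 2 = \sum_t A t j ^+ 2.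
Proof.
rewrite sqr_euclidean_norm; apply: eq_bigr => t _.
by rewrite big_ord1 mxE.
Qed.

Lemma entry_le_norm_col A t j : `|A t j| <= euclidean_norm (col j A).
Proof.
rewrite -(@ler_pXn2r _ 2)// ?nnegrE ?euclidean_norm_ge0//.
rewrite real_normK ?num_real// sqr_norm_col (bigD1 t)//= lerDl.
by rewrite sumr_ge0// => t' _; rewrite sqr_ge0.
Qed.

Lemma many_entries_le_norm_col A j (a : R) : 0 <= a ->
  (T <= 32 * #|[pred t | (a <= `|A t j|)%R]|)%N ->
  a * Num.sqrt (T%:R / 32) <= euclidean_norm (col j A).
Proof.
move=> a0; set N := #|_| => TN.
rewrite -(@ler_pXn2r _ 2)// ?nnegrE ?euclidean_norm_ge0 ?mulr_ge0 ?sqrtr_ge0//.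
rewrite sqr_norm_col exprMn sqr_sqrtr ?divr_ge0//.
apply: (@le_trans _ _ (a ^+ 2 * N%:R)).
  by rewrite ler_wpM2l ?sqr_ge0// ler_pdivrMr// -natrM ler_nat mulnC.
rewrite mulr_natr -sumr_const big_mkcond/=; apply: ler_sum => t _.
rewrite inE; case: ifP => [aA|_]; last exact: sqr_ge0.
by rewrite -[leRHS]real_normK ?num_real// lerXn2r ?nnegrE.
Qed.

End column_norms.

Section hard_families.
Context {R : realType} {T n M : nat} {d : measure_display}.
Context {Omega : measurableType d}.
Variables (X : 'I_T -> 'M[R]_(n, M)) (P : probability Omega R).
Variables (W : 'I_T * 'I_n -> {RV P >-> R}) (sigma kappa : R) (s : nat).
Hypotheses (T_gt0 : (0 < T)%N) (n_gt0 : (0 < n)%N) (s_gt0 : (0 < s)%N).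
Hypotheses (sigma0 : 0 < sigma) (iid : iid_gaussian P sigma W).
Hypothesis upper : forall Delta : 'M[R]_(T, M), Delta != 0 ->
  (group_support_size Delta <= 2 * s)%N ->
  rayleigh_quotient X Delta <= kappa ^+ 2.

(* Every estimator has, with probability 1/15, an error at least [x] in s / 32
   columns. *)
Definition hard_family (x : R) : Prop :=
  exists (I : finType) (b : I -> 'M[R]_(T, M)),
    (forall i, GS R s M T (b i)) /\
    forall tau : 'M[R]_(T, n) -> 'M[R]_(T, M),
      (forall t j, measurable_fun setT (fun y => tau y t j)) ->
      exists i, exists2 E : set Omega, measurable E /\ ((15^-1 : R)%:E <= P E)%E &
        forall w, E w -> (s <= 32 * #|[pred j | (x <= euclidean_norm
          (col j (tau (observation X P W (b i) w) - b i)))%R]|)%N.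

Lemma hard_family_le x x' : x <= x' -> hard_family x' -> hard_family x.
Proof.
move=> xx' [I [b [bGS hard]]]; exists I, b; split => // tau mtau.
have [i [E mE EP]] := hard tau mtau; exists i, E => // w /EP sx.
apply: leq_trans sx _; rewrite leq_mul2l/=; apply/subset_leq_card.
by apply/fintype.subsetP => j; rewrite !inE; exact: le_trans.
Qed.

(** The blocks are the entries of the first [s] columns, with options 0 and [a]. By [count_columns],
    the wrong entries fill a 32nd of each of s/32 columns, whence the factor
    [Num.sqrt (T%:R / 32)]. *)
Lemma hard_family_rows (a : R) : (s <= M)%N -> 0 <= a ->
  kappa ^+ 2 * (n%:R * a ^+ 2) / sigma ^+ 2 <= ln 2%:R / 2 ->
  hard_family (a / 2 * Num.sqrt (T%:R / 32)).
Proof.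
move=> sM a0 energy.
pose q (k : 'I_T * 'I_s) := (k.1, widen_ord sM k.2).
pose c (i : 'I_2) : R := if i == ord0 then 0 else a.
pose e k i : 'M[R]_(T, M) := c i *: delta_mx (q k).1 (q k).2.
have widen_inj : injective (widen_ord sM).
  by move=> j j' /(congr1 val)/= jj'; exact: val_inj.
have e_energy k i :
    euclidean_norm (design_mul X (e k i)) ^+ 2 / sigma ^+ 2 <= ln 2%:R / 2.
  apply: le_trans energy; rewrite ler_pM2r ?invr_gt0 ?exprn_gt0//.
  apply: le_trans (design_delta_le _ _ _ n_gt0 s_gt0 upper) _.
  rewrite ler_wpM2l ?sqr_ge0// ler_wpM2l// lerXn2r ?nnegrE//; rewrite /c; by case: ifP.
have e_sep k i j : i != j -> exists2 p, p \in finset.set1 (q k) &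
    a <= `|e k i p.1 p.2 - e k j p.1 p.2|.
  move=> ij; exists (q k); first by rewrite finset.in_set1.
  rewrite !mxE !eqxx !mulr1.
  by case: i j ij => [[|[|//]]] ? [[|[|//]] ?] //= _;
    rewrite /c /= ?subr0 ?sub0r ?normrN ger0_norm.
have K0 : (0 < #|{: 'I_T * 'I_s}|)%N by rewrite card_prod !card_ord muln_gt0 T_gt0.
exists {ffun 'I_T * 'I_s -> 'I_2}, (hypothesis e); split => [om|tau mtau].
  rewrite /GS/=; pose J := finset.imset (widen_ord sM) (mem predT).
  apply: leq_trans (group_support_size_le (J := J) _) _.
    move=> t j jJ; rewrite summxE big1// => -[t' j'] _; rewrite !mxE/=.
    case: (j =P _) => [jj'|_]; last by rewrite andbF mulr0.
    by case/negP: jJ; rewrite jj'; apply: finset.imset_f.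
  by apply: leq_trans (finset.leq_imset_card _ _) _; rewrite card_ord.
have [om [E mE EP]] := exists_far_hypothesis sigma0 iid (leqnn 2) e_energy e_sep mtau K0.
exists om, E => // w /EP; rewrite card_prod !card_ord.
set D := _ - _ => many.
pose b t j := a / 2 <= `|D t (widen_ord sM j)|.
have := @count_columns T s b T_gt0.
rewrite (eq_card (_ : [pred z | b z.1 z.2] =i
  [pred k | [exists (p | p \in finset.set1 (q k)), a / 2 <= `|D p.1 p.2|]]));
  last first.
  move=> k; rewrite !inE; apply/idP/existsP => [bk|[p /andP[]]].
    by exists (q k); rewrite finset.in_set1 eqxx.
  by rewrite finset.in_set1 => /eqP->.
move=> /(_ many) sJ; apply: leq_trans sJ _; rewrite leq_mul2l/=.
rewrite -(fintype.card_image widen_inj); apply/subset_leq_card/fintype.subsetP => j'.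
move=> /fintype.imageP[j]; rewrite inE => Tj ->; rewrite inE.
by apply: many_entries_le_norm_col; rewrite ?divr_ge0.
Qed.

(** Distinct blocks use disjoint sets of columns, so the wrong blocks inject into the columns with
    error at least [a / 2]. *)
Lemma hard_family_groups (m : nat) (a : R) :
  (2 <= m)%N -> (s * m <= M)%N -> 0 < a ->
  kappa ^+ 2 * (n%:R * a ^+ 2) / sigma ^+ 2 <= ln m%:R / 2 ->
  hard_family (a / 2).
Proof.
move=> m2 smM a0 energy.
have cardM : (#|{: 'I_s * 'I_m}| <= M)%N by rewrite card_prod !card_ord.
pose idx k i := widen_ord cardM (enum_rank (k : 'I_s, i : 'I_m)).
have idx_inj k i k' i' : idx k i = idx k' i' -> k = k' /\ i = i'.
  by move=> /(congr1 val)/= /val_inj /enum_rank_inj[-> ->].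
pose t0 := Ordinal T_gt0.
pose e k i : 'M[R]_(T, M) := a *: delta_mx t0 (idx k i).
pose pos k := finset.imset (fun i => (t0, idx k i)) (mem predT).
have e_energy k i :
    euclidean_norm (design_mul X (e k i)) ^+ 2 / sigma ^+ 2 <= ln m%:R / 2.
  apply: le_trans energy; rewrite ler_pM2r ?invr_gt0 ?exprn_gt0//.
  exact: (design_delta_le _ _ _ n_gt0 s_gt0 upper).
have e_sep k i j : i != j -> exists2 p, p \in pos k &
    a <= `|e k i p.1 p.2 - e k j p.1 p.2|.
  move=> ij; exists (t0, idx k i); first exact: finset.imset_f.
  rewrite !mxE !eqxx/= (_ : (idx k i == idx k j) = false).
    by rewrite mulr1 mulr0 subr0 ger0_norm// ltW.
  by apply/eqP => /idx_inj[_ ij']; rewrite ij' eqxx in ij.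
have K0 : (0 < #|'I_s|)%N by rewrite card_ord.
exists {ffun 'I_s -> 'I_m}, (hypothesis e); split => [om|tau mtau].
  rewrite /GS/=; pose J := finset.imset (fun k => idx k (om k)) (mem predT).
  apply: leq_trans (group_support_size_le (J := J) _) _.
    move=> t j jJ; rewrite summxE big1// => k _; rewrite !mxE.
    case: (j =P _) => [jk|_]; last by rewrite andbF mulr0.
    by case/negP: jJ; rewrite jk; apply: finset.imset_f.
  by apply: leq_trans (finset.leq_imset_card _ _) _; rewrite card_ord.
have [om [E mE EP]] := exists_far_hypothesis sigma0 iid m2 e_energy e_sep mtau K0.
exists om, E => // w /EP; rewrite card_ord; set D := _ - _.
set Bad := [pred k | _] => many.
(* The default [om k] is taken only outside [Bad], where any option would do. *)
pose pick k := odflt (om k) [pick i | a / 2 <= `|D t0 (idx k i)|].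
have pickP k : k \in Bad -> a / 2 <= `|D t0 (idx k (pick k))|.
  rewrite inE => /existsP[p /andP[/finset.imsetP[i _ ->] far]].
  by rewrite /pick; case: pickP => [//|/(_ i)]; rewrite far.
have inj : injective (fun k => idx k (pick k)) by move=> k k' /idx_inj[].
pose Cols := [pred j | a / 2 <= euclidean_norm (col j D)].
apply: leq_trans many _; apply: (@leq_trans (16 * #|Cols|));
  last by rewrite leq_mul2r orbT.
rewrite leq_mul2l/= -(fintype.card_image inj).
apply/subset_leq_card/fintype.subsetP => j /fintype.imageP[k kBad ->]; rewrite inE.
exact: le_trans (pickP k kBad) (entry_le_norm_col _ _ _).
Qed.

End hard_families.

(** * The rate obtained from the better of the two families *)

Section rate.
Context {R : realType} {T n M : nat} {d : measure_display}.
Context {Omega : measurableType d}.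
Variables (X : 'I_T -> 'M[R]_(n, M)) (P : probability Omega R).
Variables (W : 'I_T * 'I_n -> {RV P >-> R}) (sigma kappa : R) (s : nat).
Hypotheses (T_gt0 : (0 < T)%N) (n_gt0 : (0 < n)%N) (s_gt0 : (0 < s)%N).
Hypothesis sM : s%:R <= M%:R / 2 :> R.
Hypotheses (sigma0 : 0 < sigma) (iid : iid_gaussian P sigma W) (kappa0 : 0 < kappa).
Hypothesis upper : forall Delta : 'M[R]_(T, M), Delta != 0 ->
  (group_support_size Delta <= 2 * s)%N ->
  rayleigh_quotient X Delta <= kappa ^+ 2.

Let L : R := ln (expR 1 * M%:R / s%:R).

Let sM2 : (2 * s <= M)%N.
Proof. by rewrite -(ler_nat R) natrM; move: sM; lra. Qed.

Let sR0 : 0 < s%:R :> R. Proof. by rewrite ltr0n. Qed.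

Let MR0 : 0 < M%:R :> R. Proof. move: sM sR0; lra. Qed.

Lemma ln2_ge_half : 1 / 2 <= ln 2 :> R.
Proof.
have : ln (1 + - (1 / 2)) <= - (1 / 2) :> R by apply: le_ln1Dx; lra.
have -> : 1 + - (1 / 2) = 2^-1 :> R by field.
by rewrite lnV ?posrE// lerN2.
Qed.

Lemma log_ratio_ge0 : 0 <= L.
Proof.
rewrite /L -mulrA lnM ?posrE ?expR_gt0 ?divr_gt0// expRK addr_ge0// ln_ge0//.
by rewrite ler_pdivlMr// mul1r; move: sM sR0; lra.
Qed.

(** Let m be the quotient. Then L = 1 + ln (M / s), where 1 <= 2 ln m because m >= 2, and M / s <= m
    + 1 <= m^2. *)
Lemma log_ratio_le : L <= 4 * ln (M %/ s)%:R.
Proof.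
set m := (M %/ s)%N; have m2 : (2 <= m)%N by rewrite leq_divRL.
have lnm2 : 1 / 2 <= ln m%:R :> R.
  apply: le_trans ln2_ge_half _.
  by rewrite ler_ln ?posrE ?ltr0n ?ler_nat// (leq_trans _ m2).
rewrite /L -mulrA lnM ?posrE ?expR_gt0 ?divr_gt0// expRK.
suff : ln (M%:R / s%:R) <= ln (m%:R ^+ 2) :> R.
  by rewrite lnXn ?ltr0n ?(leq_trans _ m2)// -mulr_natl; lra.
rewrite ler_ln ?posrE ?divr_gt0 ?exprn_gt0// ?ltr0n ?(leq_trans _ m2)//.
rewrite ler_pdivrMr// -natrX -natrM ler_nat.
apply: (@leq_trans (m.+1 * s)); first by rewrite ltnW// ltn_ceil.
by rewrite leq_mul2r (_ : m.+1 <= m ^ 2)%N ?orbT//; move: m2; nia.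
Qed.

(** The unit in which entries are measured: by [energyE], the bound on the energy of an entry
    [u * c] is [c ^+ 2]. *)
Let u : R := sigma / kappa / Num.sqrt n%:R.

Let u_gt0 : 0 < u.
Proof. by rewrite !divr_gt0// sqrtr_gt0 ltr0n. Qed.

Let energyE (c : R) : kappa ^+ 2 * (n%:R * (u * c) ^+ 2) / sigma ^+ 2 = c ^+ 2.
Proof.
rewrite /u !exprMn !exprVn sqr_sqrtr ?ler0n//; field.
by rewrite !gt_eqF// ltr0n.
Qed.

Lemma hard_family_rate :
  hard_family X W s (u * Num.sqrt (T%:R + L) / 32).
Proof.
move: (u) u_gt0 energyE => v v_gt0 v_energy.
have L0 := log_ratio_ge0; have TR0 : 0 < T%:R :> R by rewrite ltr0n.
have TL0 : 0 <= T%:R + L by rewrite addr_ge0// ltW.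
have le_sqrt (x y : R) k : y <= k%:R ^+ 2 * x -> Num.sqrt y <= k%:R * Num.sqrt x.
  move=> yx; apply: le_trans (ler_wsqrtr yx) _.
  by rewrite sqrtrM ?sqr_ge0// sqrtr_sqr ger0_norm.
have [LT|/ltW TL] := leP L T%:R.
  (* The energy is 1/4, at most [ln 2 / 2]. Moreover T + L <= 2 T = 64 (T / 32), whence the factor
     8. *)
  apply: hard_family_le (hard_family_rows T_gt0 n_gt0 s_gt0 sigma0 iid upper
    (a := v * (1 / 2)) _ _ _).
  - have : Num.sqrt (T%:R + L) <= 8 * Num.sqrt (T%:R / 32) by apply: le_sqrt; lra.
    by rewrite -!mulrA ler_pM2l//; lra.
  - by apply: leq_trans sM2; rewrite leq_pmull.
  - by rewrite mulr_ge0 ?(ltW v_gt0).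
  - rewrite v_energy; have := ln2_ge_half; lra.
have m2 : (2 <= M %/ s)%N by rewrite leq_divRL.
have lnm0 : 0 < ln (M %/ s)%:R :> R by rewrite ln_gt0// ltr1n.
(* This [a] spends exactly the allowed energy. As T + L <= 2 L <= 8 ln m, the factor 16 is ample; it
   matches the constant 32 of the statement. *)
apply: hard_family_le (hard_family_groups T_gt0 n_gt0 s_gt0 sigma0 iid upper
  (m := (M %/ s)%N) (a := v * Num.sqrt (ln (M %/ s)%:R / 2)) m2 _ _ _).
- have : Num.sqrt (T%:R + L) <= 16 * Num.sqrt (ln (M %/ s)%:R / 2).
    by apply: le_sqrt; have := log_ratio_le; lra.
  by rewrite -!mulrA ler_pM2l//; lra.
- by rewrite mulnC leq_divM.
- by rewrite mulr_gt0// sqrtr_gt0 divr_gt0.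
- by rewrite v_energy sqr_sqrtr// divr_ge0// ltW.
Qed.

(** One factor 32 comes from [hard_family_rate], the other from [group_norm_lower_bound]. *)
Lemma rate_psi (p : \bar R) :
  u * Num.sqrt (T%:R + L) / 32 * s_root p s / 32 =
  psi n M T s sigma kappa p * Num.sqrt T%:R / 1024.
Proof.
have TR0 : 0 < T%:R :> R by rewrite ltr0n.
have -> : T%:R + L = T%:R * (1 + L / T%:R) by field; rewrite gt_eqF.
rewrite sqrtrM ?ltW// /psi -/(s_root p s) -/L /u.
field; rewrite !gt_eqF// sqrtr_gt0 ltr0n//.
Qed.

Lemma psi_gt0 (p : \bar R) : 0 < psi n M T s sigma kappa p.
Proof.
have s_root0 : 0 < s_root p s by rewrite /s_root; case: p => // r; rewrite powR_gt0.
rewrite /psi -/(s_root p s) -/L !mulr_gt0 ?invr_gt0 ?sqrtr_gt0 ?ltr0n//.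
by rewrite ltr_wpDr// divr_ge0// log_ratio_ge0.
Qed.

End rate.

(** * From an event of large loss to the minimax risk *)

Section risk.
Context {R : realType} {d : measure_display} {Omega : measurableType d}.
Import HBNNSimple.

(* The function need not be measurable, as its integral is by definition the
   supremum of those of the simple functions below it. *)
Lemma integral_lower_bound (mu : {measure set Omega -> \bar R}) (E : set Omega)
    (c : R) (f : Omega -> \bar R) :
  measurable E -> 0 <= c -> (forall w, 0 <= f w)%E ->
  (forall w, E w -> c%:E <= f w)%E ->
  (c%:E * mu E <= \int[mu]_w f w)%E.
Proof.
move=> mE c0 f0 Ef; rewrite ge0_integralTE//.
apply: ereal_sup_ubound; exists (scale_nnsfun (indic_nnsfun R mE) c0) => /=.
  move=> w; rewrite -[X in (X%:E <= _)%E]/(c * \1_E w) indicE.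
  have [wE|_] := boolP (w \in E).
    by rewrite mulr1 Ef//; rewrite inE in wE.
  by rewrite mulr0.
by rewrite sintegralrM sintegral_indic.
Qed.

Lemma minimax_risk_lower_bound {T n M : nat} (s : nat) (X : 'I_T -> 'M[R]_(n, M))
    (P : probability Omega R) (W : 'I_T * 'I_n -> {RV P >-> R}) loss (a c : R) :
  0 <= c -> (forall est beta, 0 <= loss est beta) ->
  (forall tau, measurable_fun setT tau -> exists2 beta, GS R s M T beta &
     exists2 E : set Omega, measurable E /\ (a%:E <= P E)%E &
       forall w, E w -> c <= loss (tau (observation X P W beta w)) beta) ->
  ((c * a)%:E <= minimax_risk s X P W loss)%E.
Proof.
move=> c0 loss0 H; apply/ereal_infP => _ [tau mtau <-].
have [beta GSb [E [mE aE] EP]] := H tau mtau.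
apply: (@le_trans _ _ ('E_P[fun w => loss (tau (observation X P W beta w)) beta])%E);
  last by apply: ereal_sup_ubound; exists beta.
rewrite unlock EFinM; apply: (@le_trans _ _ (c%:E * P E)%E).
  by rewrite lee_wpmul2l.
by apply: integral_lower_bound => // w; rewrite lee_fin//; exact: EP.
Qed.

End risk.

(** * Prediction loss *)

(** A preimage is a finite union, over tables of answers, of finite intersections of the tests or
    their complements. *)
Lemma measurable_finite_table {R : realType} d (Y : measurableType d) (I : finType)
    (q : I -> Y -> bool) (G : {ffun I -> bool} -> R) :
  (forall i, measurable [set y | q i y]) ->
  measurable_fun setT (fun y => G [ffun i => q i y]).
Proof.
move=> mq _ B _; rewrite setTI (_ : _ @^-1` _ =
    \bigcup_(v in [set v | B (G v)]) \bigcap_(i in [set: I]) [set y | q i y = v i]).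
  apply: fin_bigcup_measurable => [|v _]; first exact: finite_finset.
  apply: fin_bigcap_measurable => [|i _]; first exact: finite_finset.
  case: (v i); first exact: mq.
  rewrite (_ : [set _ | _] = ~` [set y | q i y]); first exact/measurableC/mq.
  by apply/seteqP; split => y /=; [move->|move/negP/negPf].
apply/seteqP; split => [y By|y [v Bv yv]] /=.
  by exists [ffun i => q i y] => // i _; rewrite /= ffunE.
rewrite (_ : [ffun i => q i y] = v)//.
by apply/ffunP => i; rewrite ffunE; exact: yv.
Qed.

Section prediction.
Context {R : realType} {T n M : nat}.
Variable X : 'I_T -> 'M[R]_(n, M).

Lemma sqr_euclidean_normD_le m k (A B : 'M[R]_(m, k)) :
  euclidean_norm (A + B) ^+ 2 <=
    2 * euclidean_norm A ^+ 2 + 2 * euclidean_norm B ^+ 2.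
Proof.
rewrite !sqr_euclidean_norm !mulr_sumr -big_split/=; apply: ler_sum => i _.
rewrite !mulr_sumr -big_split/=; apply: ler_sum => j _.
rewrite mxE -subr_ge0 (_ : _ - _ = (A i j - B i j) ^+ 2); last by ring.
exact: sqr_ge0.
Qed.

Lemma euclidean_normN m k (A : 'M[R]_(m, k)) : euclidean_norm (- A) = euclidean_norm A.
Proof.
congr Num.sqrt; apply: eq_bigr => i _; apply: eq_bigr => j _.
by rewrite mxE sqrrN.
Qed.

Lemma group_support_sizeB (A B : 'M[R]_(T, M)) :
  (group_support_size (A - B) <= group_support_size A + group_support_size B)%N.
Proof.
rewrite /group_support_size -cardUI; apply: leq_trans (leq_addr _ _).
apply/subset_leq_card/fintype.subsetP => j; rewrite !inE.
rewrite linearB/= -negb_and; apply: contraNN => /andP[/eqP-> /eqP->].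
by rewrite subr0.
Qed.

Lemma group_norm2 (A : 'M[R]_(T, M)) : group_norm 2%:E A = euclidean_norm A.
Proof.
rewrite /= powR12_sqrt; last by rewrite sumr_ge0// => j _; exact: powR_ge0.
congr Num.sqrt; rewrite exchange_big/=; apply: eq_bigr => j _.
by rewrite powR_mulrn ?euclidean_norm_ge0// sqr_norm_col.
Qed.

Lemma group_norm_ge0 (p : \bar R) (A : 'M[R]_(T, M)) : 0 <= group_norm p A.
Proof.
case: p => [r||] //=; first exact: powR_ge0.
by elim/big_ind: _ => // [x y x0 y0|j _]; [rewrite le_max x0|exact: euclidean_norm_ge0].
Qed.

Lemma measurable_sqr_design_norm d (Y : measurableType d) (tau : Y -> 'M[R]_(T, M)) beta :
  measurable_fun setT tau ->
  measurable_fun setT (fun y => euclidean_norm (design_mul X (tau y - beta)) ^+ 2).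
Proof.
move=> mtau; under eq_fun do rewrite sqr_euclidean_norm.
apply: measurable_sum => t; apply: measurable_sum => i.
apply: measurable_funX; under eq_fun do rewrite design_mulE.
apply: measurable_sum => j; apply: measurable_funM => //.
under eq_fun do rewrite mxE; apply: measurable_funD => //.
exact: (measurableT_comp (measurable_coord t j) mtau).
Qed.

End prediction.

Section prediction_lower_bound.
Context {R : realType} {T n M : nat}.
Variables (X : 'I_T -> 'M[R]_(n, M)) (s : nat) (kappa1 : R).
Hypotheses (n_gt0 : (0 < n)%N) (kappa1_gt0 : 0 < kappa1).
Hypothesis lower : forall Delta : 'M[R]_(T, M), Delta != 0 ->
  (group_support_size Delta <= 2 * s)%N ->
  kappa1 ^+ 2 <= rayleigh_quotient X Delta.

(** A difference of two [s]-sparse parameters is [2 * s]-sparse, so [lower] applies unless it is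
    zero. *)
Lemma design_norm_ge (beta beta' : 'M[R]_(T, M)) :
  GS R s M T beta -> GS R s M T beta' ->
  kappa1 ^+ 2 * (n%:R * euclidean_norm (beta - beta') ^+ 2) <=
    euclidean_norm (design_mul X (beta - beta')) ^+ 2.
Proof.
move=> bs b's; have [->|D0] := eqVneq (beta - beta') 0.
  have -> : euclidean_norm (0 : 'M[R]_(T, M)) ^+ 2 = 0.
    rewrite sqr_euclidean_norm !big1// => i _.
    by rewrite big1// => j _; rewrite mxE expr0n.
  by rewrite !mulr0 sqr_ge0.
have := lower D0; rewrite /rayleigh_quotient ler_pdivlMr.
  apply; apply: leq_trans (group_support_sizeB _ _) _.
  by rewrite mul2n -addnn leq_add.
rewrite mulr_gt0 ?ltr0n// lt_neqAle sqr_ge0 andbT eq_sym; apply: contra_neq D0 => D0.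
apply/matrixP => t j; rewrite [RHS]mxE; apply/eqP; rewrite -sqrf_eq0 eq_le sqr_ge0 andbT.
rewrite -D0 sqr_euclidean_norm (bigD1 t)//= (bigD1 j)//= -addrA lerDl.
rewrite addr_ge0 ?sumr_ge0// => t' _; rewrite ?sqr_ge0// sumr_ge0// => j' _.
exact: sqr_ge0.
Qed.

(** [tau'] selects a member of the family whose prediction is within [rho] of that of [tau]. If
    [b i] is also that close, the two predictions differ by less than [2 * rho], and
    [design_norm_ge] bounds the distance of the parameters by [r]. *)
Lemma prediction_far (I : finType) (b : I -> 'M[R]_(T, M)) (r : R)
    (tau : 'M[R]_(T, n) -> 'M[R]_(T, M)) :
  0 < r -> (forall i, GS R s M T (b i)) -> measurable_fun setT tau ->
  exists2 tau' : 'M[R]_(T, n) -> 'M[R]_(T, M),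
    forall t j, measurable_fun setT (fun y => tau' y t j) &
    forall y i, r <= euclidean_norm (tau' y - b i) ->
      kappa1 * Num.sqrt n%:R * r / 2 <=
        euclidean_norm (design_mul X (tau y - b i)).
Proof.
move=> r0 bGS mtau.
set rho := kappa1 * Num.sqrt n%:R * r / 2.
have rho0 : 0 < rho by rewrite !mulr_gt0// ?invr_gt0// sqrtr_gt0 ltr0n.
pose q i y := euclidean_norm (design_mul X (tau y - b i)) ^+ 2 < rho ^+ 2.
(* The value 0 is taken only when no member is close, which is excluded when [b i] is. *)
pose G (v : {ffun I -> bool}) : 'M[R]_(T, M) :=
  if [pick i | v i] is Some i then b i else 0.
exists (fun y => G [ffun i => q i y]) => [t j|y i].
  apply: (@measurable_finite_table R _ _ I q (fun v => G v t j)) => i.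
  have mf := measurable_sqr_design_norm X (b i) mtau.
  have := mf measurableT `]-oo, (rho ^+ 2)[%classic.
  rewrite setTI (_ : _ @^-1` _ = [set y | q i y]); first exact.
  by apply/seteqP; split => y /=; rewrite in_itv.
apply: contraTT; rewrite -!ltNge => close.
have qi : q i y by rewrite /q ltrXn2r ?nnegrE ?euclidean_norm_ge0// ltW.
rewrite /G; case: pickP => [i'|/(_ i)]; rewrite ffunE; last by rewrite qi.
move=> qi'; rewrite -(@ltr_pXn2r _ 2)// ?nnegrE ?euclidean_norm_ge0 ?ltW//.
rewrite -(ltr_pM2l (_ : 0 < kappa1 ^+ 2 * n%:R)) ?mulr_gt0 ?exprn_gt0 ?ltr0n//.
rewrite -mulrA; apply: le_lt_trans (design_norm_ge (bGS i') (bGS i)) _.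
have -> : b i' - b i = (tau y - b i) + - (tau y - b i').
  by rewrite opprB [RHS]addrC addrA subrK.
rewrite design_mulD design_mulN; apply: le_lt_trans (sqr_euclidean_normD_le _ _) _.
rewrite euclidean_normN.
have -> : kappa1 ^+ 2 * n%:R * r ^+ 2 = 4 * rho ^+ 2.
  by rewrite /rho !exprMn sqr_sqrtr// exprVn; field.
move: qi qi'; rewrite /q; lra.
Qed.

End prediction_lower_bound.

(** Here [q] is the normalization of the loss and [k] the numerical constant lost in the lower bound
    on [G]; multiplying by [k * x] brings the argument of the loss function up to [x]. *)
Lemma scaled_loss_ge {R : realFieldType} (k psi q G x : R) :
  0 < k -> 0 < psi -> 0 < q -> 0 <= x -> psi * q / k <= G ->
  x <= k * x * psi^-1 * (q^-1 * G).
Proof.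
move=> k0 psi0 q0 x0 HG.
rewrite (_ : k * x * psi^-1 * (q^-1 * G) = x * (G / (psi * q / k))).
  by rewrite ler_peMr// ler_pdivlMr ?mul1r// divr_gt0// mulr_gt0.
by field; rewrite !gt_eqF.
Qed.

Lemma scaled_loss_ge0 {R : realFieldType} (k psi q G x : R) :
  0 <= k -> 0 <= psi -> 0 <= q -> 0 <= x -> 0 <= G ->
  0 <= k * x * psi^-1 * (q^-1 * G).
Proof. by move=> k0 psi0 q0 x0 G0; rewrite !mulr_ge0// invr_ge0. Qed.

Theorem theorem6p1 (R : realType) (ell : R -> R)
    (ell_ge0 : forall x : R, 0 <= x -> 0 <= ell x)
    (ell_ndecr : forall x y : R, 0 <= x -> x <= y -> ell x <= ell y)
    (ell0 : ell 0 = 0)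
    (ell_neq0 : exists x : R, 0 <= x /\ ell x <> 0) :
  (forall p : \bar R, (1 <= p)%E ->
    exists b c : R, [/\ 0 < b, 0 < c &
      forall (M T n s : nat) (X : 'I_T -> 'M[R]_(n, M)) (sigma kappa2 : R)
        (d : measure_display) (Omega : measurableType d)
        (P : probability Omega R) (W : 'I_T * 'I_n -> {RV P >-> R}),
        (2 <= M)%N -> (1 <= T)%N -> (1 <= n)%N ->
        (1 <= s)%N -> s%:R <= M%:R / 2 :> R ->
        0 < sigma -> iid_gaussian P sigma W ->
        0 < kappa2 ->
        (forall Delta : 'M[R]_(T, M), Delta != 0 ->
          (group_support_size Delta <= 2 * s)%N ->
          rayleigh_quotient X Delta <= kappa2 ^+ 2) ->
        (c%:E <= minimax_risk s X P W (fun est beta =>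
           ell (b * (psi n M T s sigma kappa2 p)^-1
                * ((Num.sqrt T%:R)^-1 * group_norm p (est - beta)))%R))%E])
  /\
  (exists b c : R, [/\ 0 < b, 0 < c &
    forall (M T n s : nat) (X : 'I_T -> 'M[R]_(n, M)) (sigma kappa1 kappa2 : R)
      (d : measure_display) (Omega : measurableType d)
      (P : probability Omega R) (W : 'I_T * 'I_n -> {RV P >-> R}),
      (2 <= M)%N -> (1 <= T)%N -> (1 <= n)%N ->
      (1 <= s)%N -> s%:R <= M%:R / 2 :> R ->
      0 < sigma -> iid_gaussian P sigma W ->
      0 < kappa2 ->
      (forall Delta : 'M[R]_(T, M), Delta != 0 ->
        (group_support_size Delta <= 2 * s)%N ->
        rayleigh_quotient X Delta <= kappa2 ^+ 2) ->
      0 < kappa1 ->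
      (forall Delta : 'M[R]_(T, M), Delta != 0 ->
        (group_support_size Delta <= 2 * s)%N ->
        kappa1 ^+ 2 <= rayleigh_quotient X Delta) ->
      (c%:E <= minimax_risk s X P W (fun est beta =>
         ell (b * (psi n M T s sigma kappa2 2%:E)^-1
              * ((kappa1 * Num.sqrt (n%:R * T%:R))^-1
                 * euclidean_norm (design_mul X (est - beta))))%R))%E]).

Proof.
(* Errors are scaled so as to reach [x0], where the loss is positive; [x0] itself is positive
   because [ell 0 = 0]. *)
have [x0 [x0_ge0 ellx0]] := ell_neq0.
have c0 : 0 < ell x0 by rewrite lt_neqAle eq_sym ell_ge0// andbT; exact/eqP.
have x0_gt0 : 0 < x0.
  by rewrite lt_neqAle x0_ge0 andbT eq_sym; apply: contra_notN ellx0 => /eqP->.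
split.
  (* 1024 is the constant of [rate_psi], and 1/15 the probability of the event in [hard_family]. *)
  move=> p p1; exists (1024 * x0), (ell x0 * 15^-1).
  split=> [||M T n s X sigma kappa2 d Omega P W M2 T1 n1 s1 sM sigma0 iid k2 upper].
  - by apply: mulr_gt0; first by rewrite ltr0n.
  - by rewrite mulr_gt0// invr_gt0 ltr0n.
  have psi0 := psi_gt0 (T := T) n1 s1 sM sigma0 k2 p.
  have sqrtT : 0 < Num.sqrt T%:R :> R by rewrite sqrtr_gt0 ltr0n.
  apply: minimax_risk_lower_bound => [|est beta|tau mtau]; first exact: ltW.
    apply/ell_ge0/scaled_loss_ge0; rewrite ?ler0n ?(ltW psi0) ?(ltW sqrtT)//.
    exact: group_norm_ge0.
  have [I [b [bGS hard]]] := hard_family_rate T1 n1 s1 sM sigma0 iid k2 upper.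
  have [i [E [mE PE] EP]] := hard tau
    (fun t j => measurableT_comp (measurable_coord t j) mtau).
  exists (b i) => //; exists E => // w /EP far; apply: ell_ndecr => //.
  apply: scaled_loss_ge; rewrite ?ltr0n//.
  rewrite -rate_psi//; apply: group_norm_lower_bound => //.
  by rewrite !mulr_ge0 ?invr_ge0 ?sqrtr_ge0 ?ler0n ?ltW.
(* The additional factor 2 compensates the division by 2 in [prediction_far]. *)
exists (2048 * x0), (ell x0 * 15^-1).
split=> [||M T n s X sigma kappa1 kappa2 d Omega P W M2 T1 n1 s1 sM sigma0 iid k2
           upper k1 lower].
- by apply: mulr_gt0; first by rewrite ltr0n.
- by rewrite mulr_gt0// invr_gt0 ltr0n.
have psi0 := psi_gt0 (T := T) n1 s1 sM sigma0 k2 2%:E.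
have sqrtT : 0 < Num.sqrt T%:R :> R by rewrite sqrtr_gt0 ltr0n.
have sqrtn : 0 < Num.sqrt n%:R :> R by rewrite sqrtr_gt0 ltr0n.
have sqrtnT : Num.sqrt (n%:R * T%:R) = Num.sqrt n%:R * Num.sqrt T%:R :> R.
  by rewrite sqrtrM// ler0n.
have scale0 : 0 < kappa1 * Num.sqrt (n%:R * T%:R) by rewrite sqrtnT !mulr_gt0.
apply: minimax_risk_lower_bound => [|est beta|tau mtau]; first exact: ltW.
  apply/ell_ge0/scaled_loss_ge0; rewrite ?ler0n ?(ltW psi0) ?(ltW scale0)//.
  exact: euclidean_norm_ge0.
have [I [b [bGS hard]]] := hard_family_rate T1 n1 s1 sM sigma0 iid k2 upper.
set rho := psi n M T s sigma kappa2 2%:E * Num.sqrt T%:R / 1024.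
have rho0 : 0 < rho by apply: divr_gt0; [exact: mulr_gt0|rewrite ltr0n].
(* The hard parameter is the one found for [tau']; its estimation error in the Euclidean norm, the
   case p = 2, is then passed on to the prediction error of [tau]. *)
have [tau' mtau' tauP] := prediction_far n1 k1 lower rho0 bGS mtau.
have [i [E [mE PE] EP]] := hard tau' mtau'.
exists (b i) => //; exists E => // w /EP far; apply: ell_ndecr => //.
apply: scaled_loss_ge; rewrite ?ltr0n//.
apply: le_trans (tauP _ i _).
  by rewrite sqrtnT /rho le_eqVlt; apply/orP; left; apply/eqP; field.
rewrite -group_norm2 /rho -rate_psi//; apply: group_norm_lower_bound => //.
- by rewrite lee_fin ler1n.
- by rewrite !mulr_ge0 ?invr_ge0 ?sqrtr_ge0 ?ler0n ?ltW.
Qed.
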